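(* Let $n\ge 3$, let $A\in\mathbb{R}^{n\times n}$ be nilpotent, $B\in\mathbb{R}^{n\times m}$, $D\in\mathbb{R}^{n\times p}$ with $D\neq 0$, let the pair $\{A,B\}$ be controllable, and let $0\prec Q=Q^\top\in\mathbb{R}^{p\times p}$. Let $u$ be a homogeneous controller (as defined in the context) for some $X\in\mathbb{R}^{n\times n}$ and some dilation $\mathbf d$ in $\mathbb{R}^n$, of degree $\mu$. Let $\mathbf d_\omega(s)=e^{sG_{\mathbf d_\omega}}$ be a dilation in $\mathbb{R}^p$ such that the vector field on $\mathbb{R}^{n+p}$ $$\tilde f(x,\omega)=\begin{bmatrix}Ax+Bu(x)+D\omega\\ 0\end{bmatrix}$$ is $\tilde{\mathbf d}$-homogeneous of degree $\mu$ with respect to the dilation $\tilde{\mathbf d}(s)=\begin{bmatrix}\mathbf d(s)&0\\0&\mathbf d_\omega(s)\end{bmatrix}$ in $\mathbb{R}^{n+p}$. Suppose that the $\mathbf d$-homogeneous ellipsoid $\varepsilon_{\mathbf d}(X^{-1})$ is invariant for the closed-loop system $\dot x=Ax+Bu(x)+D\omega(t)$ with disturbances $\omega\in L^\infty(\mathbb{R}_+,\mathbb{R}^p)$, $\omega^\top(t)Q\omega(t)\le1$. If $$QG_{\mathbf d_\omega}+G_{\mathbf d_\omega}^\top Q\succ0,$$ then $\varepsilon_{\mathbf d}(X^{-1})$ is attractive for this closed-loop system.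
   Context: **Dilations.** A (linear) dilation in $\mathbb{R}^k$ is $\mathbf d(s)=e^{sG_{\mathbf d}}$, $s\in\mathbb{R}$, where the generator $G_{\mathbf d}\in\mathbb{R}^{k\times k}$ is anti-Hurwitz ($-G_{\mathbf d}$ is Hurwitz). A vector field $g:\mathbb{R}^k\to\mathbb{R}^k$ is $\mathbf d$-homogeneous of degree $\nu$ if $g(\mathbf d(s)z)=e^{\nu s}\mathbf d(s)g(z)$ for all $z\in\mathbb{R}^k\setminus\{0\}$, $s\in\mathbb{R}$. **Canonical homogeneous norm.** For $P=P^\top\succ0$ let $\|x\|_P=\sqrt{x^\top Px}$. If $PG_{\mathbf d}+G_{\mathbf d}^\top P\succ0$ (equivalently, with $X=P^{-1}$, $G_{\mathbf d}X+XG_{\mathbf d}^\top\succ0$), then $\|0\|_{\mathbf d,P}=0$ and, for $x\ne0$, $\|x\|_{\mathbf d,P}=e^{s_x}$ where $s_x\in\mathbb{R}$ is the unique number with $\|\mathbf d(-s_x)x\|_P=1$. **Homogeneous controller.** Let $\{A,B\}$ be controllable. Let $G_0\in\mathbb{R}^{n\times n}$, $Y_0\in\mathbb{R}^{m\times n}$ be any solution of $AG_0-G_0A+BY_0=A$, $G_0B=0$ (then $G_0-I_n$ is invertible). Let $\tilde n$ be the minimal natural number with $\operatorname{rank}[B,AB,\dots,A^{\tilde n-1}B]=n$, let $\mu\in[-1,1/\tilde n]$, $G_{\mathbf d}=I_n+\mu G_0$ (which is anti-Hurwitz), $\mathbf d(s)=e^{sG_{\mathbf d}}$, $K_0=Y_0(G_0-I_n)^{-1}$,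 $A_0=A+BK_0$ (one has $A_0G_{\mathbf d}=(G_{\mathbf d}+\mu I_n)A_0$, $G_{\mathbf d}B=B$). Let $X\in\mathbb{R}^{n\times n}$, $Y\in\mathbb{R}^{m\times n}$ satisfy, for some $\rho>0$, $A_0X+XA_0^\top+BY+Y^\top B^\top+\rho(G_{\mathbf d}X+XG_{\mathbf d}^\top)=0$, $G_{\mathbf d}X+XG_{\mathbf d}^\top\succ0$, $X=X^\top\succ0$. Put $P=X^{-1}$, $K=YX^{-1}$ and $$u(x)=K_0x+\|x\|_{\mathbf d,P}^{\mu+1}K\mathbf d(-\ln\|x\|_{\mathbf d,P})x\quad(x\ne0),\qquad u(0)=0 .$$ **Ellipsoid.** $\varepsilon_{\mathbf d}(P)=\{x\in\mathbb{R}^n:\|x\|_{\mathbf d,P}\le1\}$. It is *invariant* if for every admissible $\omega$ every solution with $x(0)\in\varepsilon_{\mathbf d}(P)$ satisfies $x(t)\in\varepsilon_{\mathbf d}(P)$ for all $t\ge0$; it is *attractive* if for every admissible $\omega$ every solution with $x(0)\notin\varepsilon_{\mathbf d}(P)$ satisfies $x(t)\to\varepsilon_{\mathbf d}(P)$ (distance to the set tends to $0$) as $t\to\infty$. *)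

(* Defs.v *)
From HB Require Import structures.
From mathcomp Require Import all_boot all_order all_algebra.
From mathcomp Require Import all_classical all_reals all_analysis.
From mathcomp Require Import complex.

Set Implicit Arguments.
Unset Strict Implicit.
Unset Printing Implicit Defensive.

Import Order.TTheory GRing.Theory Num.Theory.
Import numFieldNormedType.Exports.

Local Open Scope classical_set_scope.
Local Open Scope ring_scope.

Section Matrices.
Context {R : realType}.

Definition quadform k (P : 'M[R]_k) (x : 'cV[R]_k) : R := (x^T *m P *m x) 0 0.

Definition posdef k (P : 'M[R]_k) : Prop :=
  P^T = P /\ forall x : 'cV[R]_k, x != 0 -> 0 < quadform P x.

Definition nilpotent_mx k (A : 'M[R]_k) : Prop := exists j : nat, A ^+ j = 0.

(* [B, A B, ..., A^(j-1) B] *)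
Definition krylov n m (A : 'M[R]_n) (B : 'M[R]_(n, m)) (j : nat) :=
  \mxrow_(i < j) (A ^+ i *m B).

Definition controllable n m (A : 'M[R]_n) (B : 'M[R]_(n, m)) : Prop :=
  \rank (krylov A B n) = n.

(* The number written n-tilde in the definition of the controller. *)
Definition controllability_index n m (A : 'M[R]_n) (B : 'M[R]_(n, m))
    (j : nat) : Prop :=
  \rank (krylov A B j) = n /\
  forall i : nat, (i < j)%N -> \rank (krylov A B i) <> n.

Definition hurwitz k (M : 'M[R]_k) : Prop :=
  forall lambda : complex R,
    eigenvalue (map_mx (real_complex R) M) lambda -> complex.Re lambda < 0.

Definition anti_hurwitz k (G : 'M[R]_k) : Prop := hurwitz (- G).

(* Limit in the (entrywise) topology of 'M[R]_k. *)
Definition expmx k (G : 'M[R]_k) : 'M[R]_k :=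
  limn (series (fun j : nat => (j`!%:R)^-1 *: G ^+ j)).

End Matrices.

Section Homogeneity.
Context {R : realType}.

(* A dilation is [dilation G] with [anti_hurwitz G]. *)
Definition dilation k (G : 'M[R]_k) (s : R) : 'M[R]_k := expmx (s *: G).

Definition homogeneous_field k (d : R -> 'M[R]_k) (nu : R)
    (g : 'cV[R]_k -> 'cV[R]_k) : Prop :=
  forall (z : 'cV[R]_k) (s : R), z != 0 ->
    g (d s *m z) = expR (nu * s) *: (d s *m g z).

Definition pnorm k (P : 'M[R]_k) (x : 'cV[R]_k) : R := Num.sqrt (quadform P x).

(* [xget] selects s_x, which is unique when P and P G + G^T P are
   positive definite. *)
Definition hnorm k (P G : 'M[R]_k) (x : 'cV[R]_k) : R :=
  if x == 0 then 0
  else expR (xget 0 [set s : R | pnorm P (dilation G (- s) *m x) = 1]).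

Definition ellipsoid k (P G : 'M[R]_k) : set 'cV[R]_k :=
  [set x | hnorm P G x <= 1].

(* The positive definiteness of G X + X G^T is equivalent to that of
   P G + G^T P for P = X^-1.  Invertibility of G0 - I is a consequence of the
   equations for (G0, Y0) and of controllability, so [invmx] is the actual
   inverse. *)
Definition homogeneous_controller n m (A : 'M[R]_n) (B : 'M[R]_(n, m))
    (mu : R) (G X : 'M[R]_n) (u : 'cV[R]_n -> 'cV[R]_m) : Prop :=
  exists (G0 : 'M[R]_n) (Y0 : 'M[R]_(m, n)) (nt : nat)
         (Y : 'M[R]_(m, n)) (rho : R),
    let K0 := Y0 *m invmx (G0 - 1%:M) in
    let A0 := A + B *m K0 in
    let P := invmx X in
    let K := Y *m invmx X in
    [/\ A *m G0 - G0 *m A + B *m Y0 = A /\ G0 *m B = 0,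
        controllability_index A B nt /\ -1 <= mu <= nt%:R^-1,
        G = 1%:M + mu *: G0,
        [/\ 0 < rho,
            A0 *m X + X *m A0^T + B *m Y + Y^T *m B^T
              + rho *: (G *m X + X *m G^T) = 0,
            posdef (G *m X + X *m G^T) & posdef X]
      & u 0 = 0 /\
        forall x : 'cV[R]_n, x != 0 ->
          u x = K0 *m x + (hnorm P G x) `^ (mu + 1) *:
                  (K *m dilation G (- ln (hnorm P G x)) *m x)].

End Homogeneity.

Section Solutions.
Context {R : realType}.

Definition closed_convex_hull n (S : set 'cV[R]_n) : set 'cV[R]_n :=
  \bigcap_(C in [set C : set 'cV[R]_n | [/\ S `<=` C, closed C &
      convex_set (C : set (convex_lmodType 'cV[R]_n))]]) C.

(* Filippov's regularization at [x] of a field [f] that is continuous outside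
   the null set [M]: the convex closure of the limit values of [f] at [x]
   taken outside [M].  It is [[set f x]] at continuity points of [f] outside
   the closure of [M]. *)
Definition filippov n (M : set 'cV[R]_n) (f : 'cV[R]_n -> 'cV[R]_n)
    (x : 'cV[R]_n) : set 'cV[R]_n :=
  \bigcap_(r in [set r : R | 0 < r])
    closed_convex_hull (f @` (ball x r `\` M)).

(* Locally absolutely continuous x on [0, +oo[, written as the integral of its
   derivative v, such that v(t) belongs to F t (x t) for almost every t. *)
Definition solution n (F : R -> 'cV[R]_n -> set 'cV[R]_n)
    (x : R -> 'cV[R]_n) : Prop :=
  exists v : R -> 'cV[R]_n,
    [/\ forall (i : 'I_n) (T : R), 0 <= T ->
          lebesgue_measure.-integrable `[0, T] (fun t => (v t i 0)%:E),
        forall (i : 'I_n) (t : R), 0 <= t ->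
          x t i 0 = x 0 i 0 + \int[lebesgue_measure]_(s in `[0, t]) v s i 0
      & {ae lebesgue_measure, forall t : R, 0 <= t -> F t (x t) (v t)}].

(* omega in L^oo(R_+, R^p) with omega^T Q omega <= 1. *)
Definition admissible p (Q : 'M[R]_p) (omega : R -> 'cV[R]_p) : Prop :=
  [/\ forall i : 'I_p, measurable_fun (`[0, +oo[ : set R) (fun t : R => omega t i 0),
      exists c : R, {ae lebesgue_measure,
        forall t : R, 0 <= t -> forall i : 'I_p, `|omega t i 0| <= c}
    & {ae lebesgue_measure,
        forall t : R, 0 <= t -> quadform Q (omega t) <= 1}].

(* x' = A x + B u(x) + D omega(t).  The feedback u may be discontinuous at
   x = 0 (when mu = -1), and only there; elsewhere the inclusion is the
   equation itself. *)
Definition closed_loop n m p (A : 'M[R]_n) (B : 'M[R]_(n, m))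
    (D : 'M[R]_(n, p)) (u : 'cV[R]_n -> 'cV[R]_m) (omega : R -> 'cV[R]_p)
    (t : R) : 'cV[R]_n -> set 'cV[R]_n :=
  filippov [set 0] (fun y => A *m y + B *m u y + D *m omega t).

Definition invariant_set n p (Q : 'M[R]_p)
    (F : (R -> 'cV[R]_p) -> R -> 'cV[R]_n -> set 'cV[R]_n)
    (E : set 'cV[R]_n) : Prop :=
  forall (omega : R -> 'cV[R]_p) (x : R -> 'cV[R]_n),
    admissible Q omega -> solution (F omega) x ->
    E (x 0) -> forall t : R, 0 <= t -> E (x t).

Definition attractive_set n p (Q : 'M[R]_p)
    (F : (R -> 'cV[R]_p) -> R -> 'cV[R]_n -> set 'cV[R]_n)
    (E : set 'cV[R]_n) : Prop :=
  forall (omega : R -> 'cV[R]_p) (x : R -> 'cV[R]_n),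
    admissible Q omega -> solution (F omega) x ->
    ~ E (x 0) ->
    inf [set `|x t - y| | y in E] @[t --> +oo] --> (0 : R).

End Solutions.

(* Main.v *)
(** Polar coordinates x = d(s) z, z^T P z = 1, so that s = ln |x|_d.  By
homogeneity, along a solution away from the origin
  s' = e^(mu s) (- rho + z^T P D d_w(-s) w / (z^T P G z)),
the term - rho coming from the matrix equation for X and Y.

Invariance forces z^T P D w <= rho z^T P G z whenever z^T P z = 1 and
w^T Q w <= 1.  Otherwise a disturbance of the form lambda(t) d_w(eps t) w can be
chosen so that s = eps t exactly, which yields a solution leaving the ellipsoid.
It has to be continued to the whole half line: without disturbance z is rotated
by exp(tau M), with M = A0 + B K + rho G skew for P, and s solves
s' = - rho e^(mu s), so the continuation is explicit; when mu < 0 it reaches the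
origin in finite time and stays there.

The assumption on Q gives w^T Q w <= 1 -> |d_w(-s) w|_Q <= e^(-a s) for s >= 0,
hence s' <= - rho e^(mu s) (1 - e^(-a s)) < 0 outside the ellipsoid. *)

Require Import Defs.
From HB Require Import structures.
From mathcomp Require Import all_boot all_order all_algebra.
From mathcomp Require Import all_classical all_reals all_analysis.
From mathcomp Require Import measurable_realfun.
From mathcomp Require Import ring lra.

Import Order.TTheory GRing.Theory Num.Theory.
Import numFieldNormedType.Exports.

Set Implicit Arguments.
Unset Strict Implicit.
Unset Printing Implicit Defensive.

Local Open Scope classical_set_scope.
Local Open Scope ring_scope.

(** * Matrix-valued functions and the matrix exponential *)

Section MatrixAnalysis.
Context {R : realType}.

(** Invariance speaks of solutions on the whole half line, so a violated gain inequality has to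
    become an actual disturbance with an actual solution. The multiplier lambda is dictated by
    asking for s' = eps and z^T P z = 1 together. At time 0 it equals (rho + eps) z^T P G z / z^T P
    D w, which is below 1 because the inequality fails strictly and eps is small; this slack absorbs
    the growth of d_w(eps t) w for a short time. Resting at the origin, where f may jump, is a
    Filippov solution because f is odd. In the other direction the rate rho e^(mu s) (1 - e^(-a s))
    degenerates at s = 0, so there is no uniform decrease up to the boundary of the ellipsoid.
    Instead, for every del > 0 the solution reaches s <= del, the image of the ellipsoid under
    d(del), and del is then taken small. Solutions are only absolutely continuous: the decrease is
    obtained locally from integrals and propagated by induction along the real line. *)

Lemma norm_entry_le m n (M : 'M[R]_(m, n)) i j : `|M i j| <= `|M|.
Proof.
rewrite [leRHS]/Num.norm /= mx_normrE.
exact: (le_bigmax _ (fun ij : 'I_m * 'I_n => `|M ij.1 ij.2|) (i, j)).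
Qed.

Lemma mx_norm_le m n (M : 'M[R]_(m, n)) e :
  0 <= e -> (forall i j, `|M i j| <= e) -> `|M| <= e.
Proof.
move=> e0 Me; rewrite [leLHS]/Num.norm /= mx_normrE.
by apply/bigmax_leP; split => // -[i j] _; exact: Me.
Qed.

Lemma cvg_mxP T (F : set_system T) {FF : Filter F} m n
    (f : T -> 'M[R]_(m, n)) (M : 'M[R]_(m, n)) :
  f @ F --> M <-> forall i j, f x i j @[x --> F] --> M i j.
Proof.
split=> [fM i j|fM].
  apply/cvgrPdist_le => e e0; move/cvgrPdist_le : fM => /(_ _ e0).
  apply: filterS => x; apply: le_trans.
  by have := norm_entry_le (M - f x) i j; rewrite !mxE.
apply/cvgrPdist_le => e e0.
have {}fM : \forall x \near F, forall ij : 'I_m * 'I_n,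
    `|M ij.1 ij.2 - f x ij.1 ij.2| <= e.
  apply: filter_forall => -[i j] /=.
  by move/cvgrPdist_le : (fM i j) => /(_ _ e0).
apply: filterS fM => x fM.
apply: mx_norm_le; first exact: ltW.
by move=> i j; have := fM (i, j); rewrite !mxE.
Qed.

Lemma cvg_mulmx T (F : set_system T) {FF : Filter F} m n p
    (f : T -> 'M[R]_(m, n)) (g : T -> 'M[R]_(n, p))
    (M : 'M[R]_(m, n)) (N : 'M[R]_(n, p)) :
  f @ F --> M -> g @ F --> N -> (f x *m g x) @[x --> F] --> M *m N.
Proof.
move=> /cvg_mxP fM /cvg_mxP gN; apply/cvg_mxP => i j.
under eq_cvg do rewrite mxE.
rewrite mxE; apply: (@cvg_big _ _ +%R) => [|k _]; first exact: add_continuous.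
by apply: cvgM.
Qed.

(** Entrywise, so that the product rule for rectangular matrices reduces to the scalar one and
    derivatives match the integral form of a solution, which is stated by coordinates. *)
Definition mxderiv m n (F : R -> 'M[R]_(m, n)) (t : R) (dF : 'M[R]_(m, n)) :=
  forall i j, is_derive t (1 : R) (fun s => F s i j) (dF i j).

Lemma mxderiv_eq m n (F : R -> 'M[R]_(m, n)) t dF dF' :
  mxderiv F t dF -> dF = dF' -> mxderiv F t dF'.
Proof. by move=> ? <-. Qed.

Lemma mxderiv_near m n (F F' : R -> 'M[R]_(m, n)) t dF :
  mxderiv F t dF -> (\near t, F t = F' t) -> mxderiv F' t dF.
Proof.
move=> FdF FF' i j.
apply: (@near_eq_is_derive _ _ _ (fun s => F s i j)).
- by apply: filterS FF' => s ->.
- exact: FdF.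
Qed.

Lemma mxderiv_cst m n (M : 'M[R]_(m, n)) t : mxderiv (fun=> M) t 0.
Proof. by move=> i j; rewrite mxE; exact: is_derive_cst. Qed.

Lemma mxderivM m n p (F : R -> 'M[R]_(m, n)) (G : R -> 'M[R]_(n, p)) t dF dG :
  mxderiv F t dF -> mxderiv G t dG ->
  mxderiv (fun s => F s *m G s) t (dF *m G t + F t *m dG).
Proof.
move=> FdF GdG i j; rewrite !mxE -big_split /=.
have -> : (fun s => (F s *m G s) i j) =
    \sum_(k < n) ((fun s => F s i k) * (fun s => G s k j)).
  by apply/funext => s; rewrite mxE fct_sumE.
apply: is_derive_sum => k.
rewrite addrC [dF i k * _]mulrC.
exact: (is_deriveM (FdF i k) (GdG k j)).
Qed.

Lemma mxderiv_comp m n (F : R -> 'M[R]_(m, n)) (s : R -> R) t ds dF :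
  mxderiv F (s t) dF -> is_derive t (1 : R) s ds ->
  mxderiv (fun r => F (s r)) t (ds *: dF).
Proof.
move=> FdF sds i j; rewrite mxE mulrC.
exact: (is_derive1_comp (f := fun r => F r i j)).
Qed.

Lemma mxderiv_cvg m n (F : R -> 'M[R]_(m, n)) t dF :
  mxderiv F t dF -> F s @[s --> t] --> F t.
Proof.
move=> FdF; apply/cvg_mxP => i j.
by apply/differentiable_continuous/derivable1_diffP; case: (FdF i j).
Qed.

Lemma mxderiv_continuous k l (y : R -> 'M[R]_(k, l)) :
  (forall t, exists dy, mxderiv y t dy) -> continuous y.
Proof. by move=> ydy t; have [dy /mxderiv_cvg] := ydy t. Qed.

Lemma mxderiv0_cst m n (F : R -> 'M[R]_(m, n)) :
  (forall t, mxderiv F t 0) -> forall s t, F s = F t.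
Proof.
move=> F0 s t; apply/matrixP => i j.
apply: (@is_derive_0_is_cst _ (fun r => F r i j)) => r.
by have := F0 r i j; rewrite mxE.
Qed.

End MatrixAnalysis.

Section MatrixExponential.
Context {R : realType}.
Variables (k : nat) (G : 'M[R]_k).

Lemma scalemx_exp (s : R) l : (s *: G) ^+ l = s ^+ l *: G ^+ l.
Proof.
elim: l => [|l IHl]; first by rewrite !expr0 scale1r.
by rewrite !exprS IHl -!mulmxE -scalemxAl -scalemxAr scalerA.
Qed.

Lemma expr_entry_le : exists2 K : R, 0 <= K &
  forall l i j, `|(G ^+ l) i j| <= K ^+ l.
Proof.
exists (k%:R * `|G|); first by rewrite mulr_ge0.
elim=> [|l IHl] i j.
  by rewrite !expr0 mxE normr_nat; case: (i == j).
rewrite exprS -mulmxE mxE exprS -mulrA.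
apply: le_trans (ler_norm_sum _ _ _) _.
have -> : k%:R * (`|G| * (k%:R * `|G|) ^+ l) =
    \sum_(o < k) (`|G| * (k%:R * `|G|) ^+ l).
  by rewrite sumr_const card_ord mulr_natl.
apply: ler_sum => o _; rewrite normrM ler_pM //; exact: norm_entry_le.
Qed.

(** Coefficients of the scalar power series of one entry of [dilation G]; differentiation is carried
    out on these series. *)
Definition expmx_coeff i j : R^nat := fun l => (l`!%:R)^-1 * (G ^+ l) i j.

(** Comparison with the exponential series at K |x|. *)
Lemma cvg_entire (c : R^nat) (K C : R) : 0 <= K ->
  (forall l, `|c l| <= C * (K ^+ l / l`!%:R)) ->
  forall x, cvgn (pseries c x).
Proof.
move=> K0 cK x; rewrite /pseries.
apply: (@normed_cvg R R^o).
apply: (@series_le_cvg _ _ (fun l => C * exp_coeff (K * `|x|) l)).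
- by move=> l; exact: normr_ge0.
- move=> l; have := cK l; rewrite /exp_coeff /= => cl.
  have {}cl := le_trans (normr_ge0 _) cl.
  by rewrite exprMn mulrAC mulrA mulr_ge0 // exprn_ge0.
- move=> l; rewrite /exp_coeff /= normrM normrX exprMn.
  by rewrite mulrAC mulrA ler_wpM2r ?exprn_ge0.
- apply: is_cvg_seriesZ; exact: is_cvg_series_exp_coeff.
Qed.

Lemma pseries_diffs_expmx_coeff i j :
  pseries_diffs (expmx_coeff i j) =
  fun l => (l`!%:R)^-1 * (G ^+ l.+1) i j.
Proof.
apply/funext => l; rewrite /pseries_diffs /expmx_coeff factS natrM invfM.
by rewrite mulrA mulVKf.
Qed.

(** The shifts [a = 1] and [a = 2] are the first and second formal derivatives of the entry series,
    whose convergence termwise differentiation requires. *)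
Lemma cvg_expmx_shift a i j x :
  cvgn (pseries (fun l => (l`!%:R)^-1 * (G ^+ (a + l)) i j) x).
Proof.
have [K K0 GK] := expr_entry_le.
apply: (@cvg_entire _ K (K ^+ a)) => // l.
rewrite normrM ger0_norm ?invr_ge0 // mulrC mulrA -exprD.
by rewrite ler_wpM2r ?invr_ge0.
Qed.

Lemma cvg_expmx i j x : cvgn (pseries (expmx_coeff i j) x).
Proof. exact: (@cvg_expmx_shift 0 i j x). Qed.

Lemma dilation_entry s i j :
  dilation G s i j = limn (pseries (expmx_coeff i j) s).
Proof.
rewrite /dilation /expmx.
have H : series (fun l => (l`!%:R)^-1 *: (s *: G) ^+ l) @ \oo -->
    (\matrix_(i, j) limn (pseries (expmx_coeff i j) s)).
  apply/cvg_mxP => i' j'; rewrite mxE.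
  have -> : (fun x => series (fun l : nat => l`!%:R^-1 *: (s *: G) ^+ l) x i' j')
     = pseries (expmx_coeff i' j') s.
    apply/funext => N; rewrite /pseries /series /= summxE.
    apply: eq_bigr => l _.
    by rewrite scalemx_exp !mxE /expmx_coeff mulrA mulrAC.
  exact: cvg_expmx.
by rewrite (cvg_lim _ H) ?mxE.
Qed.

Lemma dilation_entry_deriv s i j :
  is_derive s (1 : R) (fun t => dilation G t i j)
    (limn (pseries (fun l => (l`!%:R)^-1 * (G ^+ l.+1) i j) s)).
Proof.
have -> : (fun t => dilation G t i j) =
    (fun t => limn (pseries (expmx_coeff i j) t)).
  by apply/funext => t; exact: dilation_entry.
rewrite -pseries_diffs_expmx_coeff.
apply: (@pseries_snd_diffs _ _ (`|s| + 1)).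
- exact: cvg_expmx.
- rewrite pseries_diffs_expmx_coeff; exact: (@cvg_expmx_shift 1).
- have -> : pseries_diffs (pseries_diffs (expmx_coeff i j)) =
     fun l => (l`!%:R)^-1 * (G ^+ l.+2) i j.
    apply/funext => l; rewrite pseries_diffs_expmx_coeff /pseries_diffs factS.
    by rewrite natrM invfM mulrA mulVKf.
  exact: (@cvg_expmx_shift 2).
- by rewrite [X in _ < X]ger0_norm ?ltrDl ?addr_ge0.
Qed.

Lemma dilation_deriv s : mxderiv (dilation G) s (G *m dilation G s).
Proof.
move=> i j; apply: is_derive_eq; first exact: dilation_entry_deriv.
rewrite mxE; apply/cvg_lim => //.
under eq_bigr do rewrite dilation_entry.
rewrite (_ : pseries _ s =
    fun N => \sum_(l < k) G i l * pseries (expmx_coeff l j) s N); last first.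
  apply/funext => N; rewrite /pseries /series /=.
  under [RHS]eq_bigr do rewrite mulr_sumr.
  rewrite exchange_big /=; apply: eq_bigr => l _.
  rewrite exprS -mulmxE mxE mulr_sumr mulr_suml; apply: eq_bigr => o _.
  by rewrite /expmx_coeff; ring.
apply: (@cvg_big _ _ +%R) => [|o _]; first exact: add_continuous.
by apply: cvgM; [exact: cvg_cst|exact: cvg_expmx].
Qed.

(** Obtained by splitting the powers of [G] from the other side, so no commutation of [G] with its
    exponential is invoked. This form keeps [d s] as a left factor when polar coordinates are
    differentiated. *)
Lemma dilation_derivr s : mxderiv (dilation G) s (dilation G s *m G).
Proof.
move=> i j; apply: is_derive_eq; first exact: dilation_entry_deriv.
rewrite mxE; apply/cvg_lim => //.
under eq_bigr do rewrite dilation_entry.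
rewrite (_ : pseries _ s =
    fun N => \sum_(l < k) pseries (expmx_coeff i l) s N * G l j); last first.
  apply/funext => N; rewrite /pseries /series /=.
  under [RHS]eq_bigr do rewrite mulr_suml.
  rewrite exchange_big /=; apply: eq_bigr => l _.
  rewrite exprSr -mulmxE mxE mulr_sumr mulr_suml; apply: eq_bigr => o _.
  by rewrite /expmx_coeff; ring.
apply: (@cvg_big _ _ +%R) => [|o _]; first exact: add_continuous.
by apply: cvgM; [exact: cvg_expmx|exact: cvg_cst].
Qed.

Lemma dilation0 : dilation G 0 = 1%:M.
Proof.
apply/matrixP => i j; rewrite dilation_entry; apply/cvg_lim => //.
rewrite -(cvg_shiftS _).
rewrite (_ : (fun n => _) = cst ((1%:M : 'M[R]_k) i j)); first exact: cvg_cst.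
apply/funext => N; rewrite /pseries /series /= big_nat_recl // big1 ?addr0.
  by rewrite /expmx_coeff fact0 !expr0 invr1 mul1r mulr1.
by move=> l _; rewrite expr0n mulr0.
Qed.

Lemma dilation_opp_deriv t :
  mxderiv (fun r => dilation G (- r)) t (- (dilation G (- t) *m G)).
Proof.
apply: mxderiv_eq (mxderiv_comp (dilation_derivr (- t)) (is_deriveNid t 1)) _.
by rewrite scaleN1r.
Qed.

(** The left side has derivative zero in [t], hence equals its value at [t = 0]; the group law
    follows without a Cauchy product of series. *)
Lemma dilationND t s : dilation G (- t) *m dilation G (t + s) = dilation G s.
Proof.
have H0 r : mxderiv (fun r => dilation G (- r) *m dilation G (r + s)) r 0.
  have dr : is_derive r (1 : R) (fun r => r + s) 1.
    rewrite -[X in is_derive _ _ _ X]addr0.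
    exact: (is_deriveD (is_derive_id r 1) (is_derive_cst s r 1)).
  have dF := @mxderiv_comp _ _ _ (dilation G) (fun r => r + s) r _ _
    (dilation_deriv (r + s)) dr.
  apply: mxderiv_eq (mxderivM (dilation_opp_deriv r) dF) _.
  by rewrite scale1r mulNmx mulmxA addNr.
by rewrite (mxderiv0_cst H0 t 0) oppr0 dilation0 mul1mx add0r.
Qed.

Lemma dilationNK t : dilation G (- t) *m dilation G t = 1%:M.
Proof. by have := dilationND t 0; rewrite addr0 dilation0. Qed.

Lemma dilationKN t : dilation G t *m dilation G (- t) = 1%:M.
Proof. by have := dilationNK (- t); rewrite opprK. Qed.

Lemma dilationD t s : dilation G (t + s) = dilation G t *m dilation G s.
Proof. by rewrite -(dilationND t s) mulmxA dilationKN mul1mx. Qed.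

Lemma dilation_eq0 t (x : 'cV[R]_k) : (dilation G t *m x == 0) = (x == 0).
Proof.
apply/eqP/eqP => [tx|->]; last by rewrite mulmx0.
by rewrite -[x]mul1mx -(dilationNK t) -mulmxA tx mulmx0.
Qed.

End MatrixExponential.

(** * Quadratic forms and the homogeneous norm *)

Section QuadraticForms.
Context {R : realType}.

Definition bilform k (P : 'M[R]_k) (x y : 'cV[R]_k) : R := (x^T *m P *m y) 0 0.

Lemma quadformE k (P : 'M[R]_k) x : quadform P x = bilform P x x.
Proof. by []. Qed.

Lemma bilformDl k (P : 'M[R]_k) x y z :
  bilform P (x + y) z = bilform P x z + bilform P y z.
Proof. by rewrite /bilform linearD !mulmxDl mxE. Qed.

Lemma bilformDr k (P : 'M[R]_k) x y z :
  bilform P x (y + z) = bilform P x y + bilform P x z.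
Proof. by rewrite /bilform mulmxDr mxE. Qed.

Lemma bilformZl k (P : 'M[R]_k) a x y :
  bilform P (a *: x) y = a * bilform P x y.
Proof. by rewrite /bilform linearZ -!scalemxAl mxE. Qed.

Lemma bilformZr k (P : 'M[R]_k) a x y :
  bilform P x (a *: y) = a * bilform P x y.
Proof. by rewrite /bilform -scalemxAr mxE. Qed.

Lemma bilformNr k (P : 'M[R]_k) x y : bilform P x (- y) = - bilform P x y.
Proof. by rewrite -scaleN1r bilformZr mulN1r. Qed.

Lemma bilform_tr k (P : 'M[R]_k) x y : bilform P^T x y = bilform P y x.
Proof.
rewrite /bilform -[in RHS](trmxK (y^T *m P *m x)) [in RHS]mxE.
by rewrite !trmx_mul trmxK mulmxA.
Qed.

Lemma bilformC k (P : 'M[R]_k) x y : P^T = P -> bilform P x y = bilform P y x.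
Proof. by move=> PT; rewrite -[in LHS]PT bilform_tr. Qed.

Lemma quadformD k (P : 'M[R]_k) x y : P^T = P ->
  quadform P (x + y) = quadform P x + 2 * bilform P x y + quadform P y.
Proof.
move=> PT; rewrite !quadformE bilformDl !bilformDr.
by rewrite [bilform P y x]bilformC //; ring.
Qed.

Lemma quadformZ k (P : 'M[R]_k) a x : quadform P (a *: x) = a ^+ 2 * quadform P x.
Proof. by rewrite !quadformE bilformZl bilformZr mulrA. Qed.

(** Thus positive definiteness of the Lyapunov form says that [quadform P] grows along the
    dilation. *)
Lemma quadform_lyap k (P G : 'M[R]_k) x : P^T = P ->
  quadform (P *m G + G^T *m P) x = 2 * bilform P x (G *m x).
Proof.
move=> PT; rewrite /quadform mulmxDr mulmxDl mxE mulr2n mulrDl mul1r.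
congr (_ + _); first by rewrite /bilform !mulmxA.
by rewrite bilformC // /bilform trmx_mul !mulmxA.
Qed.

Lemma posdef_ge0 k (P : 'M[R]_k) x : posdef P -> 0 <= quadform P x.
Proof.
case=> _ P0; have [->|/P0/ltW//] := eqVneq x 0.
by rewrite /quadform mulmx0 mxE.
Qed.

Lemma cauchy_schwarz k (P : 'M[R]_k) x y : posdef P ->
  bilform P x y ^+ 2 <= quadform P x * quadform P y.
Proof.
move=> P0; have PT := P0.1.
have [->|y0] := eqVneq y 0.
  by rewrite /quadform /bilform !mulmx0 !mxE mulr0 expr0n.
have Ny : 0 < quadform P y by apply P0.
(* Up to the factor [quadform P y], this vector is the component of [x] that is P-orthogonal to
   [y]. *)
have := posdef_ge0 (quadform P y *: x + (- bilform P x y) *: y) P0.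
rewrite quadformD // !quadformZ bilformZl bilformZr.
rewrite (_ : _ + _ = quadform P y *
  (quadform P x * quadform P y - bilform P x y ^+ 2)); last by ring.
by rewrite pmulr_rge0 // subr_ge0.
Qed.

Lemma posdef_unit k (P : 'M[R]_k) : posdef P -> P \in unitmx.
Proof.
case=> _ P0; rewrite -row_free_unit -kermx_eq0; apply/rowV0P => v.
move=> /sub_kermxP vP; apply/eqP/negPn/negP => v0.
have := P0 v^T; rewrite trmx_eq0 => /(_ v0).
by rewrite /quadform trmxK vP mul0mx mxE ltxx.
Qed.

Lemma posdef_inv k (P : 'M[R]_k) : posdef P -> posdef (invmx P).
Proof.
move=> P0; have uP := posdef_unit P0; have PT : (invmx P)^T = invmx P.
  by rewrite trmx_inv P0.1.
have NE x : quadform (invmx P) x = quadform P (invmx P *m x).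
  by rewrite /quadform trmx_mul PT mulmxKV // mulmxA.
split=> // x x0; rewrite NE; apply P0.
apply: contraNN x0 => /eqP xP.
by rewrite -(mulKVmx uP x) xP mulmx0.
Qed.

Lemma bilform_le k (M : 'M[R]_k) x y :
  `|bilform M x y| <= (k%:R * k%:R * `|M|) * `|x| * `|y|.
Proof.
have -> : bilform M x y = \sum_j \sum_i x i 0 * M i j * y j 0.
  rewrite /bilform mxE; apply: eq_bigr => j _; rewrite mxE mulr_suml.
  by apply: eq_bigr => i _; rewrite mxE.
apply: le_trans (ler_norm_sum _ _ _) _.
have -> : k%:R * k%:R * `|M| * `|x| * `|y| =
    \sum_(j < k) \sum_(i < k) `|x| * `|M| * `|y|.
  rewrite !sumr_const card_ord !mulr_natl -[in RHS]mulr_natl -[in RHS]mulr_natl.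
  by ring.
apply: ler_sum => j _; apply: le_trans (ler_norm_sum _ _ _) _.
apply: ler_sum => i _; rewrite !normrM ler_pM // ?norm_entry_le //.
by rewrite ler_pM // norm_entry_le.
Qed.

Lemma quadform_le k (M : 'M[R]_k) x :
  `|quadform M x| <= (k%:R * k%:R * `|M|) * `|x| ^+ 2.
Proof. by rewrite expr2 mulrA; exact: bilform_le. Qed.

(* The i-th coordinate of x is the P-product of x with P^-1 e_i. *)
Lemma posdef_lower k (P : 'M[R]_k) : posdef P ->
  exists2 C : R, 0 < C & forall x, `|x| ^+ 2 <= C * quadform P x.
Proof.
move=> P0; have uP := posdef_unit P0.
pose e (i : 'I_k) : 'cV[R]_k := delta_mx i 0.
(* The summand 1 keeps [C] positive even in dimension zero. *)
pose C := 1 + \sum_i quadform (invmx P) (e i).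
have C0 i : quadform (invmx P) (e i) <= C.
  rewrite /C (bigD1 i) //= addrCA lerDl addr_ge0 // sumr_ge0 // => j _.
  exact/posdef_ge0/posdef_inv.
have Cgt0 : 0 < C.
  rewrite /C ltr_pwDl // sumr_ge0 // => j _; exact/posdef_ge0/posdef_inv.
exists C => // x.
have Nx := posdef_ge0 x P0.
have CNx : 0 <= C * quadform P x by rewrite mulr_ge0 // ltW.
rewrite -[leRHS]sqr_sqrtr // ler_sqr ?nnegrE ?sqrtr_ge0 //.
apply: mx_norm_le => [|i j]; first exact: sqrtr_ge0.
rewrite ord1 -ler_sqr ?nnegrE ?sqrtr_ge0 // sqr_sqrtr // real_normK ?num_real //.
have -> : x i 0 = bilform P (invmx P *m e i) x.
  rewrite /bilform trmx_mul trmx_inv P0.1 mulmxKV // trmx_delta.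
  by rewrite -rowE mxE.
apply: le_trans (cauchy_schwarz _ _ P0) _.
rewrite ler_wpM2r // (le_trans _ (C0 i)) //.
by rewrite /quadform trmx_mul trmx_inv P0.1 mulmxKV // mulmxA.
Qed.

Lemma quadform_deriv k (P : 'M[R]_k) (y : R -> 'cV[R]_k) t dy : P^T = P ->
  mxderiv y t dy ->
  is_derive t (1 : R) (fun s => quadform P (y s)) (2 * bilform P (y t) dy).
Proof.
move=> PT ydy.
have yT : mxderiv (fun s => (y s)^T) t dy^T.
  move=> i j; rewrite mxE.
  under [X in is_derive _ _ X]eq_fun do rewrite mxE.
  exact: ydy.
have yTP := mxderivM yT (mxderiv_cst P t).
have := mxderivM yTP ydy 0 0.
rewrite mulmx0 addr0 mxE -!/(bilform _ _ _) bilformC // => H.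
by rewrite mulr2n mulrDl mul1r.
Qed.

Lemma derive_ge0_le (f df : R -> R) (a b : R) : a <= b ->
  (forall t, a <= t <= b -> is_derive t (1 : R) f (df t)) ->
  (forall t, a <= t <= b -> 0 <= df t) -> f a <= f b.
Proof.
rewrite le_eqVlt => /predU1P[->//|ab] fdf df0.
have [||c] := @MVT R f df a b ab.
- by move=> t; rewrite in_itv /= => /andP[at_ tb]; apply: fdf; rewrite !ltW.
- apply: derivable_within_continuous => t.
  by rewrite in_itv /= => tab; have [] := fdf _ tab.
rewrite in_itv /= => /andP[ac cb] fE; rewrite -subr_ge0 fE.
by rewrite mulr_ge0 ?df0 ?subr_ge0 ?ltW // !ltW.
Qed.

(** Gronwall in both directions: the two positive definite forms are comparable, so along the orbit
    the derivative of [quadform P] lies between [a] and [b] times its value. Multiplying by e^(-a r)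
    or e^(-b r) gives a monotone function. *)
Lemma dilation_growth k (P G : 'M[R]_k) : posdef P ->
  posdef (P *m G + G^T *m P) ->
  exists a b : R, [/\ 0 < a, 0 < b & forall x r, 0 <= r ->
    expR (a * r) * quadform P x <= quadform P (dilation G r *m x) /\
    quadform P (dilation G r *m x) <= expR (b * r) * quadform P x].
Proof.
move=> P0 S0; set S := _ + _ in S0.
have [Cp Cp0 CpP] := posdef_lower P0.
have [Cs Cs0 CsP] := posdef_lower S0.
pose up := 1 + k%:R * k%:R * `|P|; pose us := 1 + k%:R * k%:R * `|S|.
have up0 : 0 < up by rewrite ltr_pwDl // !mulr_ge0.
have us0 : 0 < us by rewrite ltr_pwDl // !mulr_ge0.
have upP x : quadform P x <= up * `|x| ^+ 2.
  apply: le_trans (ler_norm _) (le_trans (quadform_le _ _) _).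
  by rewrite ler_wpM2r ?exprn_ge0 // lerDr.
have usP x : quadform S x <= us * `|x| ^+ 2.
  apply: le_trans (ler_norm _) (le_trans (quadform_le _ _) _).
  by rewrite ler_wpM2r ?exprn_ge0 // lerDr.
pose a := (up * Cs)^-1; pose b := us * Cp.
have a0 : 0 < a by rewrite invr_gt0 mulr_gt0.
have b0 : 0 < b by rewrite mulr_gt0.
have aS y : a * quadform P y <= quadform S y.
  rewrite ler_pdivrMl ?mulr_gt0 //; apply: le_trans (upP y) _.
  by rewrite -mulrA ler_pM2l.
have bS y : quadform S y <= b * quadform P y.
  by apply: le_trans (usP y) _; rewrite -mulrA ler_pM2l.
exists a, b; split=> // x r r0.
have dN t : is_derive t (1 : R) (fun s => quadform P (dilation G s *m x))
    (quadform S (dilation G t *m x)).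
  rewrite quadform_lyap ?P0.1 //; apply: quadform_deriv; first exact: P0.1.
  apply: mxderiv_eq (mxderivM (dilation_deriv G t) (mxderiv_cst x t)) _.
  by rewrite mulmx0 addr0 mulmxA.
have dE c t : is_derive t (1 : R)
    (fun s => expR (c * s) * quadform P (dilation G s *m x))
    (expR (c * t) * (quadform S (dilation G t *m x)
      + c * quadform P (dilation G t *m x))).
  have dc : is_derive t (1 : R) (fun s : R => c * s) c.
    by apply: is_derive_eq; rewrite /GRing.scale /= mulr1.
  have de := is_derive1_comp (is_derive_expR (c * t)) dc.
  apply: is_derive_eq (is_deriveM de (dN t)) _.
  by rewrite /GRing.scale /=; ring.
split.
  have : expR (- a * 0) * quadform P (dilation G 0 *m x) <=
         expR (- a * r) * quadform P (dilation G r *m x).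
    apply: derive_ge0_le r0 (fun t _ => dE (- a) t) _ => t _.
    by rewrite mulr_ge0 ?expR_ge0 // mulNr subr_ge0.
  rewrite mulr0 expR0 mul1r dilation0 mul1mx mulNr expRN mulrC => h.
  by rewrite mulrC -ler_pdivlMr ?expR_gt0.
have : - (expR (- b * 0) * quadform P (dilation G 0 *m x)) <=
       - (expR (- b * r) * quadform P (dilation G r *m x)).
  apply: (@derive_ge0_le (fun t => - (expR (- b * t) * _)) _ _ _ r0
    (fun t _ => is_deriveN (dE (- b) t))) => t _.
  by rewrite oppr_ge0 mulr_ge0_le0 ?expR_ge0 // mulNr subr_le0.
rewrite lerN2 mulr0 expR0 mul1r dilation0 mul1mx mulNr expRN mulrC => h.
by rewrite mulrC -ler_pdivrMr ?expR_gt0.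
Qed.

End QuadraticForms.

Section HomogeneousNorm.
Context {R : realType}.

Lemma mulmx_continuous m n p (M : 'M[R]_(m, n)) :
  continuous (fun x : 'M[R]_(n, p) => M *m x).
Proof.
move=> x; apply: (@cvg_mulmx _ _ (nbhs x) (nbhs_filter x)); first exact: cvg_cst.
exact: cvg_id.
Qed.

Lemma cvg_bilform T (F : set_system T) {FF : Filter F} k (P : 'M[R]_k)
    (f g : T -> 'cV[R]_k) x y :
  f @ F --> x -> g @ F --> y -> bilform P (f t) (g t) @[t --> F] --> bilform P x y.
Proof.
move=> fx gy.
have fT : (f t)^T @[t --> F] --> x^T.
  apply/cvg_mxP => i j; rewrite mxE; under eq_cvg do rewrite mxE.
  by move/cvg_mxP : fx; apply.
have : (f t)^T *m P *m g t @[t --> F] --> x^T *m P *m y.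
  by apply: cvg_mulmx gy; apply: cvg_mulmx fT _; exact: cvg_cst.
by move=> /cvg_mxP /(_ 0 0).
Qed.

Variables (k : nat) (P G : 'M[R]_k).
Hypotheses (P0 : posdef P) (S0 : posdef (P *m G + G^T *m P)).

Let N := quadform P.
Let d := dilation G.

Lemma quadform_dilation_incr x s t : x != 0 -> s < t -> N (d s *m x) < N (d t *m x).
Proof.
move=> x0 st; have [a [b [a0 _ /(_ (d s *m x) (t - s))]]] := dilation_growth P0 S0.
rewrite subr_ge0 ltW // => /(_ isT) [+ _].
rewrite mulmxA -dilationD subrK; apply: lt_le_trans.
rewrite ltr_pMl ?expR_gt1 ?mulr_gt0 ?subr_gt0 //.
by apply P0; rewrite dilation_eq0.
Qed.

Lemma quadform_dilation_continuous x :
  continuous (fun s => N (d s *m x)).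
Proof.
move=> s; apply: cvg_bilform; apply: cvg_mulmx; try exact: cvg_cst.
  exact: mxderiv_cvg (dilation_deriv _ _).
exact: mxderiv_cvg (dilation_deriv _ _).
Qed.

Lemma hnorm_ex x : x != 0 -> exists s, N (d (- s) *m x) = 1.
Proof.
move=> x0; have [a [b [a0 _ Nd]]] := dilation_growth P0 S0.
have Nx : 0 < N x by apply P0.
(* With this [r] the growth bound gives N (d(-r) x) <= 1 <= N (d(r) x), which is what the
   intermediate value theorem needs. *)
pose r := `|ln (N x)| / a; have r0 : 0 <= r by rewrite divr_ge0 // ltW.
have ar : a * r = `|ln (N x)| by rewrite mulrC divfK // gt_eqF.
have [+ _] := Nd x r r0; have [+ _] := Nd (d (- r) *m x) r r0.
rewrite mulmxA -dilationD subrr dilation0 mul1mx -!/(N _) ar => lo hi.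
have [|||c _ Nc] := @IVT R (fun s => N (d s *m x)) (- r) r 1.
- by rewrite ge0_cp.
- exact/continuous_subspaceT/quadform_dilation_continuous.
- apply/andP; split.
    rewrite ge_min; apply/orP; left.
    rewrite -(ler_pM2l (expR_gt0 `|ln (N x)|)) mulr1; apply: le_trans lo _.
    by rewrite -[leLHS]lnK ?posrE // ler_expR ler_norm.
  rewrite le_max; apply/orP; right; apply: le_trans hi.
  rewrite -[X in _ <= _ * X]lnK ?posrE // -expRD -expR0 ler_expR -lerBlDr sub0r.
  by rewrite -normrN ler_norm.
by exists (- c); rewrite opprK.
Qed.

Lemma pnorm_eq1 x : pnorm P x = 1 <-> N x = 1.
Proof.
rewrite /pnorm -/(N x); split=> [|->]; last exact: sqrtr1.
move=> /(congr1 (fun y => y ^+ 2)); rewrite sqr_sqrtr ?posdef_ge0 //.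
by rewrite expr1n.
Qed.

Lemma hnormP x : x != 0 ->
  exists s, hnorm P G x = expR s /\ N (d (- s) *m x) = 1.
Proof.
move=> x0; rewrite /hnorm (negPf x0); set A := [set s | _].
exists (xget 0 A); split=> //.
by case: (xgetP 0 A) => [s _ /pnorm_eq1//|] As;
  have [s /pnorm_eq1/As] := hnorm_ex x0.
Qed.

(** Comparisons of the homogeneous norm become comparisons of an ordinary quadratic form, continuous
    in [x] and [s], so that the choice made by [xget] never has to be inspected again. At [x = 0]
    both sides hold. *)
Lemma hnorm_le x s : (hnorm P G x <= expR s) = (N (d (- s) *m x) <= 1).
Proof.
have [->|x0] := eqVneq x 0.
  by rewrite /hnorm eqxx expR_ge0 mulmx0 /N /quadform mulmx0 mxE ler01.
have [t [-> Nt]] := hnormP x0; rewrite ler_expR -Nt.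
have [ts|st|->] := ltgtP t s; last by rewrite lexx.
  by rewrite ltW // quadform_dilation_incr // ltrN2.
by rewrite leNgt quadform_dilation_incr // ltrN2.
Qed.

Lemma hnorm_lt x s : (hnorm P G x < expR s) = (N (d (- s) *m x) < 1).
Proof.
have [->|x0] := eqVneq x 0.
  by rewrite /hnorm eqxx expR_gt0 mulmx0 /N /quadform mulmx0 mxE ltr01.
have [t [-> Nt]] := hnormP x0; rewrite ltr_expR -Nt.
have [ts|st|->] := ltgtP t s; last by rewrite ltxx.
  by rewrite quadform_dilation_incr // ltrN2.
by rewrite ltNge ltW // quadform_dilation_incr // ltrN2.
Qed.

Lemma hnorm_eq x s : N (d (- s) *m x) = 1 -> hnorm P G x = expR s.
Proof.
move=> Ns; apply/eqP; rewrite eq_le hnorm_le Ns lexx /=.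
by rewrite leNgt hnorm_lt Ns ltxx.
Qed.

Lemma hnorm_dilation z s : N z = 1 -> hnorm P G (d s *m z) = expR s.
Proof. by move=> Nz; apply: hnorm_eq; rewrite mulmxA dilationNK mul1mx. Qed.

Lemma hnorm_gt0 x : x != 0 -> 0 < hnorm P G x.
Proof. by move=> /hnormP[s [-> _]]; exact: expR_gt0. Qed.

Lemma hnorm_polar x : x != 0 -> exists s z, x = d s *m z /\ N z = 1.
Proof.
move=> /hnormP[s [_ Ns]]; exists s, (d (- s) *m x); split=> //.
by rewrite mulmxA dilationKN mul1mx.
Qed.

Lemma hnormN x : hnorm P G (- x) = hnorm P G x.
Proof.
have E : [set s : R | pnorm P (dilation G (- s) *m - x) = 1] =
    [set s | pnorm P (dilation G (- s) *m x) = 1].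
  apply/funext => s; rewrite /mkset /pnorm mulmxN -scaleN1r quadformZ.
  by rewrite sqrrN expr1n mul1r.
by rewrite /hnorm oppr_eq0 E.
Qed.

Lemma hnorm_continuous (x : 'cV[R]_k) : x != 0 -> hnorm P G y @[y --> x] --> hnorm P G x.
Proof.
move=> x0; have V0 := hnorm_gt0 x0.
have cN s : N (d s *m y) @[y --> x] --> N (d s *m x).
  have dc : d s *m y @[y --> x] --> d s *m x.
    exact: mulmx_continuous.
  exact: (@cvg_bilform _ (nbhs x) (nbhs_filter x)).
apply/(@cvgrPdist_lt _ _ _ _ (nbhs_filter x)) => e e0.
(* The maximum with half the norm keeps the lower level positive, hence an exponential. *)
pose V1 := Num.max (hnorm P G x - e) (hnorm P G x / 2).
have V10 : 0 < V1 by rewrite lt_max divr_gt0 ?orbT.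
have V20 : 0 < hnorm P G x + e by rewrite addr_gt0.
have lo : hnorm P G x < expR (ln (hnorm P G x + e)).
  by rewrite lnK ?posrE // ltrDl.
have hi : expR (ln V1) < hnorm P G x.
  rewrite lnK ?posrE // gt_max ltrBlDr ltrDl e0 /=.
  by rewrite ltr_pdivrMr // ltr_pMr // ltr1n.
rewrite hnorm_lt in lo.
have {}hi : 1 < N (d (- ln V1) *m x) by rewrite ltNge -hnorm_le -ltNge.
have {}lo := @cvgr_lt _ _ _ (nbhs_filter x) _ _ (cN _) _ lo.
have {}hi := @cvgr_gt _ _ _ (nbhs_filter x) _ _ (cN _) _ hi.
apply: filterS2 lo hi => y; rewrite -hnorm_lt lnK ?posrE // => lo.
rewrite ltNge -hnorm_le -ltNge lnK ?posrE // gt_max => /andP[hi _].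
by rewrite ltr_distlC hi lo.
Qed.

End HomogeneousNorm.

(** * Filippov sets at points of continuity and at the origin *)

Section Filippov.
Context {R : realType}.
Variables (k : nat) (f : 'cV[R]_k -> 'cV[R]_k).

Lemma filippov_mem (M : set 'cV[R]_k) x : ~ M x -> filippov M f x (f x).
Proof.
move=> Mx r /= r0 C [+ _ _]; apply.
by exists x => //; split=> //; exact: ballxx.
Qed.

Lemma closed_ball_norm_closed (c : 'cV[R]_k) e : closed [set y | `|c - y| <= e].
Proof.
have cn : continuous (fun y : 'cV[R]_k => `|c - y|).
  move=> y; apply: (@cvg_norm _ _ _ (nbhs y) (nbhs_filter y)).
  apply: (@cvgB _ _ _ (nbhs y) (nbhs_filter y)); first exact: cvg_cst.
  exact: cvg_id.
exact: (closed_comp (fun y _ => cn y) (@closed_le R e)).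
Qed.

Lemma closed_ball_norm_convex (c : 'cV[R]_k) e :
  convex_set ([set y | `|c - y| <= e] : set (convex_lmodType 'cV[R]_k)).
Proof.
move=> x y t; rewrite !inE /= => cx cy.
have -> : c - conv t x y = (t%:num : R) *: (c - x) + (1 - t%:num : R) *: (c - y).
  rewrite !scalerBr [in LHS](_ : conv t x y = (t%:num : R) *: x + (1 - t%:num : R) *: y) //.
  by rewrite [in RHS]addrACA -scalerDl [_ + (1 - _)]addrC subrK scale1r -opprD.
have t0 : 0 <= (t%:num : R) by [].
have t1 : 0 <= (1 - t%:num : R) by rewrite subr_ge0.
apply: le_trans (ler_normD _ _) _; rewrite !normrZ !ger0_norm //.
have -> : e = t%:num * e + (1 - t%:num) * e by ring.
by rewrite lerD // ler_wpM2l.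
Qed.

(** Closed balls around [f x] are closed, convex, and contain the values of [f] near [x]; the
    Filippov set lies in all of them. *)
Lemma filippov_eq (M : set 'cV[R]_k) (x v : 'cV[R]_k) :
  f y @[y --> x] --> f x -> filippov M f x v -> v = f x.
Proof.
move=> fx Fv; apply/eqP; rewrite eq_sym -subr_eq0 -normr_le0.
apply/ler_addgt0Pr => e e0; rewrite add0r.
have /(@cvgrPdist_le _ _ _ _ (nbhs_filter x))/(_ _ e0) := fx.
move=> /nbhs_ballP[r /= r0 rf].
apply: (Fv r r0 [set y | `|f x - y| <= e]); split.
- by move=> _ [y [xy _] <-]; exact: rf.
- exact: closed_ball_norm_closed.
- exact: closed_ball_norm_convex.
Qed.

(** Zero is the midpoint of [f y] and [f (- y)] for arbitrarily small nonzero [y]. This lets a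
    solution rest at the origin even when [f] is discontinuous there. *)
Lemma filippov_odd0 : (0 < k)%N -> (forall x, f (- x) = - f x) ->
  filippov [set 0] f 0 0.
Proof.
move=> k0 fN r /= r0 C [fC _ Cconv].
pose y : 'cV[R]_k := const_mx (r / 2).
have y0 : y != 0.
  apply/eqP => /matrixP /(_ (Ordinal k0) 0); rewrite !mxE => /eqP.
  by rewrite gt_eqF // divr_gt0.
have yr : `|y| < r.
  apply: le_lt_trans (_ : r / 2 < r); last first.
    by rewrite ltr_pdivrMr // ltr_pMr // ltr1n.
  apply: mx_norm_le => [|i j]; first by rewrite divr_ge0 // ltW.
  by rewrite mxE ger0_norm // divr_ge0 // ltW.
have Cy : C (f y).
  apply: fC; exists y => //; split; last exact/eqP.
  by rewrite mx_norm_ball /ball_ /= sub0r normrN.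
have CNy : C (f (- y)).
  apply: fC; exists (- y) => //; split; last by apply/eqP; rewrite oppr_eq0.
  by rewrite mx_norm_ball /ball_ /= sub0r opprK.
have h0 : 0 <= (2^-1 : R) by rewrite invr_ge0.
have h1 : (2^-1 : R) <= 1 by rewrite invf_le1 // ler1n.
have /= := Cconv (f y) (f (- y)) (Itv01 h0 h1).
rewrite !inE => /(_ Cy CNy) C0.
have : C ((2^-1 : R) *: f y + (1 - 2^-1 : R) *: f (- y)) by exact: C0.
rewrite fN scalerN -scalerBl (_ : _ - _ = 0 :> R) ?scale0r //.
by field.
Qed.

End Filippov.

(** * The undisturbed closed loop in polar coordinates *)

Section Feedback.
Context {R : realType}.
Variables (k : nat) (P G : 'M[R]_k).
Hypotheses (P0 : posdef P) (S0 : posdef (P *m G + G^T *m P)).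
(** In the application [A0] is A + B K0, [L] is B K, and [f] is the closed loop without
    disturbance. *)
Variables (A0 L : 'M[R]_k) (mu : R) (f : 'cV[R]_k -> 'cV[R]_k).
Hypothesis fE : forall x, x != 0 ->
  f x = A0 *m x + (hnorm P G x) `^ (mu + 1) *:
    (L *m dilation G (- ln (hnorm P G x)) *m x).

Lemma feedback_polar z s : quadform P z = 1 ->
  f (dilation G s *m z) =
  A0 *m (dilation G s *m z) + expR ((mu + 1) * s) *: (L *m z).
Proof.
move=> Nz; rewrite fE; last first.
  rewrite dilation_eq0; apply/eqP => z0.
  by move: Nz; rewrite z0 /quadform mulmx0 mxE => /eqP; rewrite eq_sym oner_eq0.
rewrite hnorm_dilation // expRK -mulmxA (mulmxA (dilation G (- s))) dilationNK.
by rewrite mul1mx -expRM [s * _]mulrC.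
Qed.

Lemma feedback_sphere z : quadform P z = 1 -> f z = (A0 + L) *m z.
Proof.
move=> Nz; have := feedback_polar 0 Nz.
by rewrite dilation0 !mul1mx mulr0 expR0 scale1r mulmxDl.
Qed.

Lemma feedback_odd x : f 0 = 0 -> f (- x) = - f x.
Proof.
move=> f0; have [->|x0] := eqVneq x 0; first by rewrite oppr0 f0 oppr0.
by rewrite !fE ?oppr_eq0 // hnormN !mulmxN scalerN opprD.
Qed.

Lemma feedback_continuous (x : 'cV[R]_k) : x != 0 -> f y @[y --> x] --> f x.
Proof.
move=> x0; have FF := nbhs_filter x.
have V0 := hnorm_gt0 P0 S0 x0.
have cV := hnorm_continuous P0 S0 x0.
have cln : ln (hnorm P G y) @[y --> x] --> ln (hnorm P G x).
  by apply: (@continuous_cvg _ _ _ (nbhs x) FF (hnorm P G) (@ln R)) => //; exact: continuous_ln.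
have y0 : \forall y \near x, y != 0.
  exact: (@cvgr_neq0 _ _ _ _ FF id x cvg_id x0).
(* Near [x] the norm is positive, where the real power is the exponential of a multiple of [ln];
   continuity is proved for that expression. *)
have fxE : \forall y \near x, A0 *m y + expR ((mu + 1) * ln (hnorm P G y)) *:
    (L *m dilation G (- ln (hnorm P G y)) *m y) = f y.
  apply: filterS y0 => y y0; have Vy := hnorm_gt0 P0 S0 y0.
  by rewrite (fE y0) /powR (gt_eqF Vy).
rewrite -(nbhs_singleton fxE).
apply: cvg_trans (near_eq_cvg fxE) _.
apply: (@cvgD _ _ _ (nbhs x) FF); first exact: mulmx_continuous.
apply: (@cvgZ _ _ _ (nbhs x) FF).
  apply: (@continuous_cvg _ _ _ (nbhs x) FF _ expR); first exact: continuous_expR.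
  by apply: (@cvgM _ _ (nbhs x) FF) => //; exact: cvg_cst.
apply: (@cvg_mulmx _ _ _ FF); last exact: cvg_id.
apply: (@cvg_mulmx _ _ _ FF); first exact: cvg_cst.
apply: (@continuous_cvg _ _ _ (nbhs x) FF _ (dilation G)).
  exact: mxderiv_cvg (dilation_deriv _ _).
exact: (@cvgN _ _ _ (nbhs x) FF).
Qed.

End Feedback.

(** * Integrals on intervals and ordinary differential equations *)

Section IntervalIntegrals.
Context {R : realType}.
Notation leb := (@lebesgue_measure R).
Implicit Types (f g : R -> R) (a b c : R).

Lemma ae_imp (A B : R -> Prop) : {ae leb, forall t, A t} ->
  (forall t, A t -> B t) -> {ae leb, forall t, B t}.
Proof.
move=> A_ae AB; apply: filterS A_ae; last exact: AB.
exact: (ae_filter_ringOfSetsType leb).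
Qed.

Lemma ae_and (A B : R -> Prop) : {ae leb, forall t, A t} ->
  {ae leb, forall t, B t} -> {ae leb, forall t, A t /\ B t}.
Proof.
move=> A_ae B_ae; apply: filterS2 A_ae B_ae; last by [].
exact: (ae_filter_ringOfSetsType leb).
Qed.

Lemma integrable_sub f a b c d : a <= c -> d <= b ->
  leb.-integrable `[a, b] (EFin \o f) -> leb.-integrable `[c, d] (EFin \o f).
Proof.
move=> ac db; apply: integrableS => //.
by apply: subset_itv; rewrite bnd_simp.
Qed.

Lemma lebesgue_itv_fine a b : a <= b -> fine (leb `[a, b]) = b - a.
Proof.
rewrite le_eqVlt => /predU1P[->|ab].
  by rewrite set_itv1 lebesgue_measure_set1 subrr.
by rewrite lebesgue_measure_itv /= lte_fin ab.
Qed.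

Lemma lebesgue_itv_lty a b : (leb `[a, b] < +oo)%E.
Proof.
rewrite lebesgue_measure_itv /=; case: ifPn => // _.
by rewrite -EFinB ltry.
Qed.

Lemma Rintegral_chasles f a b c : a <= b -> b <= c ->
  leb.-integrable `[a, c] (EFin \o f) ->
  \int[leb]_(x in `[a, c]) f x =
  \int[leb]_(x in `[a, b]) f x + \int[leb]_(x in `[b, c]) f x.
Proof.
move=> ab bc fi; apply/eqP; rewrite -subr_eq0 opprD addrA subr_eq0; apply/eqP.
rewrite Rintegral_itvB // ?bnd_simp //.
rewrite Rintegral_itv_obnd_cbnd //.
apply: integrableS fi => //; apply: subset_itv; rewrite bnd_simp //.
Qed.

Lemma eq_Rintegral_oc f g a b :
  leb.-integrable `[a, b] (EFin \o f) -> leb.-integrable `[a, b] (EFin \o g) ->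
  (forall t, a < t <= b -> f t = g t) ->
  \int[leb]_(x in `[a, b]) f x = \int[leb]_(x in `[a, b]) g x.
Proof.
have oc h : leb.-integrable `[a, b] (EFin \o h) ->
    leb.-integrable `]a, b] (EFin \o h).
  by apply: integrableS => //; apply: subset_itv; rewrite bnd_simp.
move=> /oc fi /oc gi fg.
rewrite -(Rintegral_itv_obnd_cbnd fi) -(Rintegral_itv_obnd_cbnd gi).
by apply: eq_Rintegral => t; rewrite inE /= in_itv /=; exact: fg.
Qed.

Lemma bounded_integrable f a b C : measurable_fun setT f ->
  (forall t, a <= t <= b -> `|f t| <= C) ->
  leb.-integrable `[a, b] (EFin \o f).
Proof.
move=> mf fC; apply: measurable_bounded_integrable => //.
- exact: lebesgue_itv_lty.
- exact: measurable_funS mf.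
- exists C; split; first exact: num_real.
  move=> M CM t /=; rewrite in_itv /= => /fC ftC.
  exact: le_trans ftC (ltW CM).
Qed.

Lemma continuous_integrable f a b : continuous f ->
  leb.-integrable `[a, b] (EFin \o f).
Proof.
move=> cf; apply: continuous_compact_integrable; first exact: segment_compact.
exact: continuous_subspaceT.
Qed.

(** The bound holds only almost everywhere, so [f] is replaced by [Num.min (f t) c], which agrees
    with it almost everywhere and is at most [c] everywhere. *)
Lemma Rintegral_ae_le f a b c : a <= b ->
  leb.-integrable `[a, b] (EFin \o f) ->
  {ae leb, forall t, a <= t <= b -> f t <= c} ->
  \int[leb]_(x in `[a, b]) f x <= c * (b - a).
Proof.
move=> ab fi fc; have /integrableP[mf _] := fi.
have mf' : measurable_fun `[a, b] f by exact/measurable_EFinP.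
have ci : leb.-integrable `[a, b] (EFin \o cst c).
  by apply: continuous_integrable => ?; exact: cvg_cst.
have mg : measurable_fun `[a, b] (fun t => Num.min (f t) c).
  by apply: measurable_minr.
have fg : ae_eq leb `[a, b]%classic (EFin \o f) (EFin \o (fun t => Num.min (f t) c)).
  refine (@ae_imp _ _ fc _) => t {}fc /=; rewrite in_itv /= => /fc ftc.
  by rewrite (min_idPl ftc).
have -> : \int[leb]_(x in `[a, b]) f x =
    \int[leb]_(x in `[a, b]) Num.min (f x) c.
  by congr fine; apply: ae_eq_integral => //; exact/measurable_EFinP.
rewrite -(lebesgue_itv_fine ab) -Rintegral_cst //.
apply: le_Rintegral => //; last by move=> t _; rewrite ge_min lexx orbT.
apply/integrableP; split; first exact/measurable_EFinP.
have /integrableP[_] := fi; apply: le_lt_trans.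
rewrite le_eqVlt; apply/orP; left; apply/eqP.
apply: ae_eq_integral => //.
- by apply: measurableT_comp => //; exact/measurable_EFinP.
- exact: measurableT_comp.
- refine (@ae_imp _ _ fc _) => t {}fc /=; rewrite in_itv /= => /fc ftc.
  by rewrite (min_idPl ftc).
Qed.

Lemma Rintegral_norm_le f a b C : a <= b ->
  leb.-integrable `[a, b] (EFin \o f) ->
  {ae leb, forall t, a <= t <= b -> `|f t| <= C} ->
  `|\int[leb]_(x in `[a, b]) f x| <= C * (b - a).
Proof.
move=> ab fi fC; rewrite ler_norml; apply/andP; split.
  rewrite lerNl -mulN1r -RintegralZl //.
  apply: Rintegral_ae_le => //.
    rewrite (_ : EFin \o _ = (fun x => (-1)%:E * (f x)%:E)%E) //.
    exact: integrableZl.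
  refine (@ae_imp _ _ fC _) => t {}fC /fC; rewrite ler_norml => /andP[+ _].
  by rewrite mulN1r lerNl.
apply: Rintegral_ae_le => //.
by refine (@ae_imp _ _ fC _) => t {}fC /fC; rewrite ler_norml => /andP[_].
Qed.

Lemma ge0_small_eq0 (a K : R) : 0 <= K -> 0 <= a ->
  (forall e, 0 < e -> a <= K * e) -> a = 0.
Proof.
move=> K0 a0 aK; apply/eqP; rewrite eq_le a0 andbT.
apply/ler_addgt0Pr => e e0; rewrite add0r.
have K1 : 0 < K + 1 by rewrite ltr_wpDl.
have := aK (e / (K + 1)); rewrite divr_gt0 // => /(_ isT) /le_trans; apply.
by rewrite mulrA ler_pdivrMr // mulrC ler_pM2l // lerDl.
Qed.

(* The derivative [v] need not have limits at the end points. *)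
Lemma Rintegral_deriv (x v : R -> R) a b C : a <= b ->
  measurable_fun setT v -> (forall t, a <= t <= b -> `|v t| <= C) ->
  {within `[a, b], continuous x} ->
  (forall t, a < t < b -> is_derive t (1 : R) x (v t)) ->
  (forall t, a < t < b -> {for t, continuous v}) ->
  x b = x a + \int[leb]_(t in `[a, b]) v t.
Proof.
rewrite le_eqVlt => /predU1P[->|ab] mv vC cx xv cv.
  by rewrite set_itv1 Rintegral_set1 addr0.
have C0 : 0 <= C by apply: le_trans (vC a _); rewrite ?normr_ge0 // lexx ltW.
have vi : leb.-integrable `[a, b] (EFin \o v) by exact: bounded_integrable vC.
have inner a' b' : a < a' -> a' < b' -> b' < b ->
    x b' - x a' = \int[leb]_(t in `[a', b']) v t.
  move=> aa' ab' bb'.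
  have sub t : a' <= t <= b' -> a < t < b.
    by move=> /andP[a't tb']; rewrite (lt_le_trans aa') //= (le_lt_trans tb').
  rewrite /Rintegral (@continuous_FTC2 _ v x) //.
  - apply: continuous_in_subspaceT => t; rewrite inE /= in_itv /= => /sub.
    exact: cv.
  - have xc t : a' <= t <= b' -> {for t, continuous x}.
      move=> /sub tab; have [dx _] := xv t tab.
      exact/differentiable_continuous/derivable1_diffP.
    split.
    + move=> t; rewrite in_itv /= => /andP[a't tb'].
      by have [] := xv t (sub t _); rewrite // !ltW.
    + by apply: cvg_at_right_filter; apply: xc; rewrite lexx ltW.
    + by apply: cvg_at_left_filter; apply: xc; rewrite lexx ltW.
  - move=> t; rewrite in_itv /= => /andP[a't tb'].
    have /xv[_ <-] : a < t < b by apply: sub; rewrite !ltW.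
    by rewrite derive1E.
have [_ xa xb] := (continuous_within_itvP x ab).1 cx.
apply/eqP; rewrite -subr_eq0 -normr_eq0; apply/eqP.
(* The fundamental theorem holds on inner intervals [[a', b']]. Each of the two end pieces costs [e]
   for the increment of [x] and [C * e] for the integral of [v]. *)
apply: (@ge0_small_eq0 _ (2 + 2 * C)) => // [|e e0].
  by rewrite addr_ge0 // mulr_ge0.
move/cvgrPdist_le : xa => /(_ _ e0) xa.
move/cvgrPdist_le : xb => /(_ _ e0) xb.
have m_ab : a < (a + b) / 2 < b by rewrite !midf_lt.
have [a' [aa' a'm a'e xa']] : exists a', [/\ a < a', a' < (a + b) / 2,
    a' <= a + e & `|x a - x a'| <= e].
  near a^'+ => t; exists t; split; near: t => //.
  - exact: nbhs_right_gt.
  - by apply: nbhs_right_lt; case/andP : m_ab.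
  - by apply: nbhs_right_le; rewrite ltrDl.
have [b' [bb' b'm b'e xb']] : exists b', [/\ b' < b, (a + b) / 2 < b',
    b - e <= b' & `|x b - x b'| <= e].
  near b^'- => t; exists t; split; near: t => //.
  - exact: nbhs_left_lt.
  - by apply: nbhs_left_gt; case/andP : m_ab.
  - by apply: nbhs_left_ge; rewrite gtrBl.
have a'b' : a' < b' by apply: lt_trans b'm.
rewrite (@Rintegral_chasles _ _ a') //; [|exact: ltW|by rewrite ltW // (lt_trans a'b')].
rewrite (@Rintegral_chasles _ a' b') //; [|exact: ltW|exact: ltW|]; last first.
  by apply: integrable_sub vi => //; exact: ltW.
rewrite -(inner a' b') //.
have Ia : `|\int[leb]_(t in `[a, a']) v t| <= C * (a' - a).
  apply: Rintegral_norm_le; first exact: ltW.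
    by apply: integrable_sub vi => //; rewrite ltW // (lt_trans a'b').
  apply: aeW => t /andP[at_ ta']; apply: vC; rewrite at_ (le_trans ta') //.
  by rewrite ltW // (lt_trans a'b').
have Ib : `|\int[leb]_(t in `[b', b]) v t| <= C * (b - b').
  apply: Rintegral_norm_le; first exact: ltW.
    by apply: integrable_sub vi => //; rewrite ltW // (lt_trans _ a'b').
  apply: aeW => t /andP[bt tb]; apply: vC; rewrite tb (le_trans _ bt) //.
  by rewrite ltW // (lt_trans _ a'b').
set I1 := \int[leb]_(t in `[a, a']) v t in Ia *.
set I2 := \int[leb]_(t in `[b', b]) v t in Ib *.
rewrite (_ : x b - _ = (x b - x b') + (- (x a - x a')) + (- I1) + (- I2)); last by ring.
have -> : (2 + 2 * C) * e = e + e + C * e + C * e by ring.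
apply: le_trans (ler_normD _ _) _; apply: lerD; last first.
  by rewrite normrN (le_trans Ib) // ler_wpM2l // lerBlDr -lerBlDl.
apply: le_trans (ler_normD _ _) _; apply: lerD; last first.
  by rewrite normrN (le_trans Ia) // ler_wpM2l // lerBlDl.
by apply: le_trans (ler_normD _ _) _; rewrite normrN lerD.
Unshelve. all: by end_near. Qed.

(** An envelope cut off at the level [a] falls no faster than its uncut part. *)
Lemma max_subr_le (a b k : R) : 0 <= k ->
  Num.max a b - k <= Num.max a (b - k).
Proof. by move=> k0; have [?|?] := leP a b; have [?|?] := leP a (b - k); lra. Qed.

(** Let T be the supremum of the times up to which [good] holds: the second hypothesis gives
    [good T], the third passes beyond T. This stands in for a comparison theorem for differential
    inequalities. *)
Lemma real_induction (good : R -> Prop) : good 0 ->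
  (forall t, 0 < t -> (forall u, 0 <= u < t -> good u) -> good t) ->
  (forall t, 0 <= t -> good t ->
    exists2 e, 0 < e & forall h, 0 <= h <= e -> good (t + h)) ->
  forall t, 0 <= t -> good t.
Proof.
move=> good0 goodC goodS t1 t10; apply: contrapT => bad.
pose E := [set t : R | 0 <= t <= t1 /\ forall u, 0 <= u <= t -> good u].
have E0 : E 0.
  split; first by rewrite lexx.
  by move=> u; rewrite -eq_le => /eqP <-.
have Eub : ubound E t1 by move=> t [/andP[]].
have supE : has_sup E by split; [exists 0|exists t1].
pose T := sup E.
have T_0 : 0 <= T by apply: ub_le_sup => //; exists t1.
have Tt1 : T <= t1 by apply: ge_sup => //; exists 0.
have below u : 0 <= u < T -> good u.
  move=> /andP[u0 uT]; have Tu : 0 < T - u by rewrite subr_gt0.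
  have [t [_ gt_]] := sup_adherent Tu supE.
  by rewrite subKr => ut; apply: gt_; rewrite u0 ltW.
have gT : good T.
  by move: T_0; rewrite le_eqVlt => /predU1P[<-//|T_0]; exact: goodC.
have T_lt : T < t1 by rewrite lt_neqAle Tt1 andbT; apply/eqP => TE; apply: bad; rewrite -TE.
have [e e0 ge] := goodS T T_0 gT.
pose h := Num.min e (t1 - T).
have h0 : 0 < h by rewrite lt_min e0 subr_gt0.
have ETh : E (T + h).
  split; first by rewrite addr_ge0 ?(ltW h0) // -lerBrDl ge_min lexx orbT.
  move=> u /andP[u0 uTh]; have [uT|Tu] := ltP u T; first by apply: below; rewrite u0.
  rewrite -(subrKC T u); apply: ge; rewrite subr_ge0 Tu lerBlDl (le_trans uTh) //.
  by rewrite lerD2l ge_min lexx.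
have : T + h <= T by apply: ub_le_sup => //; exists t1.
by rewrite gerDl leNgt h0.
Qed.

Lemma Rintegral_lincomb (I : Type) (r : seq I) (l : I -> R) (g : I -> R -> R) a b :
  (forall i, leb.-integrable `[a, b] (EFin \o g i)) ->
  leb.-integrable `[a, b] (EFin \o (fun t => \sum_(i <- r) l i * g i t)) /\
  \int[leb]_(t in `[a, b]) (\sum_(i <- r) l i * g i t) =
  \sum_(i <- r) l i * \int[leb]_(t in `[a, b]) g i t.
Proof.
move=> gi; elim: r => [|i r [IHi IHe]].
  split.
    have -> : (fun t : R => \sum_(i <- [::]) l i * g i t) = cst 0.
      by apply/funext => t; rewrite big_nil.
    by apply: continuous_integrable => t; exact: cvg_cst.
  rewrite big_nil (_ : (fun _ => _) = cst 0); last first.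
    by apply/funext => t; rewrite big_nil.
  by rewrite Rintegral_cst // mul0r.
have hi : leb.-integrable `[a, b] (EFin \o (fun t => l i * g i t)).
  rewrite (_ : EFin \o _ = (fun x => ((l i)%:E * (EFin \o g i) x)%E)) //.
  exact: integrableZl.
have -> : (fun t => \sum_(j <- i :: r) l j * g j t) =
    (fun t => l i * g i t + \sum_(j <- r) l j * g j t).
  by apply/funext => t; rewrite big_cons.
split.
  rewrite (_ : EFin \o _ = ((EFin \o (fun t => l i * g i t)%R) \+
    (EFin \o (fun t => \sum_(j <- r) l j * g j t)%R))%E) //.
  exact: integrableD.
by rewrite RintegralD // big_cons IHe RintegralZl.
Qed.

End IntervalIntegrals.

(** * Picard iteration for bounded, globally Lipschitz fields *)

Section Picard.
Context {R : realType}.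
Notation leb := (@lebesgue_measure R).

Lemma geometric_increments (u : R^nat) (K : R) :
  (forall n, `|u n.+1 - u n| <= K / 2 ^+ n) ->
  forall n, `|limn u - u n| <= 2 * K / 2 ^+ n.
Proof.
move=> uK.
have K0 : 0 <= K by apply: le_trans (normr_ge0 _) (le_trans (uK 0) _); rewrite expr0 divr1.
(* Subtracting the remaining tail makes the geometric bound provable by induction on [m]. *)
have inc n m : `|u (n + m)%N - u n| <= 2 * K / 2 ^+ n - 2 * K / 2 ^+ (n + m).
  elim: m => [|m IHm]; first by rewrite addn0 !subrr normr0.
  rewrite addnS -[u _ - u n](subrKA (u (n + m)%N)).
  apply: le_trans (ler_normD _ _) _.
  apply: le_trans (lerD (uK _) IHm) _.
  rewrite le_eqVlt; apply/orP; left; apply/eqP.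
  by rewrite exprS invfM; set c := (2 ^+ (n + m))^-1; set c' := (2 ^+ n)^-1; field.
have cu : cvgn u.
  have -> : u = (fun n => series (telescope u) n + u 0%N).
    by apply/funext => n; rewrite telescopeK /= subrK.
  suff cs : cvgn (series (telescope u)).
    apply/cvg_ex; exists (limn (series (telescope u)) + u 0%N).
    by apply: cvgD => //; exact: cvg_cst.
  apply: (@normed_cvg R R^o).
  apply: (@series_le_cvg _ _ (geometric K 2^-1)) => [n|n|n|].
  - exact: normr_ge0.
  - by rewrite /geometric /= mulr_ge0 // exprn_ge0 // invr_ge0.
  - by rewrite /telescope /geometric /= exprVn; exact: uK.
  - by apply: is_cvg_geometric_series; rewrite ger0_norm ?invr_ge0 // invf_lt1 // ltr1n.
move=> n; apply/ler_addgt0Pr => e e0.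
have /cvgrPdist_le /(_ _ e0) [N _ Nu] := cu.
have /(_ (n + N)%N) := Nu; rewrite /= leq_addl => /(_ isT) h.
rewrite (_ : limn u - u n = (u (n + N)%N - u n) + (limn u - u (n + N)%N)); last by ring.
apply: le_trans (ler_normD _ _) (lerD (le_trans (inc n N) _) h).
by rewrite gerBl divr_ge0 ?exprn_ge0 // mulr_ge0.
Qed.

Lemma le_geometric (a b K : R) : (forall n, a <= b + K / 2 ^+ n) -> a <= b.
Proof.
move=> abK; have : (fun n => b + K / 2 ^+ n) @ \oo --> b.
  rewrite -[X in _ --> X]addr0; apply: cvgD; first exact: cvg_cst.
  rewrite (_ : (fun _ => _) = geometric K 2^-1); last first.
    by apply/funext => n; rewrite /geometric /= exprVn.
  by apply: cvg_geometric; rewrite ger0_norm ?invr_ge0 // invf_lt1 // ltr1n.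
move=> h; apply: (ler_cvg_to (cvg_cst a) h).
by near=> n; exact: abK.
Unshelve. all: by end_near. Qed.

Lemma continuous_entry k (y : R -> 'cV[R]_k) i :
  continuous y -> continuous (fun t => y t i 0).
Proof. by move=> cy t; have /cvg_mxP := cy t; exact. Qed.

(** Negative end points are allowed: there the interval is empty and the integral is zero, so the
    estimate holds on the whole line. *)
Lemma indefinite_lip (phi : R -> R) C : continuous phi ->
  (forall t, `|phi t| <= C) -> forall b b',
  `|\int[leb]_(s in `[0, b]) phi s - \int[leb]_(s in `[0, b']) phi s| <=
    C * `|b - b'|.
Proof.
move=> cphi phiC b b'.
have C0 : 0 <= C by apply: le_trans (phiC 0).
have key : forall b b', b <= b' ->
    `|\int[leb]_(s in `[0, b']) phi s - \int[leb]_(s in `[0, b]) phi s| <=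
    C * (b' - b).
  move=> {}b {}b' bb'; have [b0|b0] := leP 0 b.
    rewrite (@Rintegral_chasles _ _ 0 b b') // ?addrK; last first.
    - exact: continuous_integrable.
    rewrite addrAC subrr add0r.
    by apply: Rintegral_norm_le => //; [exact: continuous_integrable|exact: aeW].
  rewrite [in X in _ - X]set_itv_ge ?bnd_simp -?ltNge // Rintegral_set0 subr0.
  have [b'0|b'0] := leP 0 b'.
    apply: le_trans (@Rintegral_norm_le _ phi 0 b' C _ _ _) _ => //.
    - exact: continuous_integrable.
    - exact: aeW.
    - by rewrite ler_wpM2l // lerD2l oppr0 lerNr oppr0 ltW.
  rewrite [in X in `|X|]set_itv_ge ?bnd_simp -?ltNge // Rintegral_set0 normr0.
  by rewrite mulr_ge0 // subr_ge0.
have [bb'|/ltW bb'] := leP b b'.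
  by rewrite distrC [`|b - b'|]distrC [`|b' - b|]ger0_norm ?subr_ge0 // key.
by rewrite [`|b - b'|]ger0_norm ?subr_ge0 // key.
Qed.

Lemma indefinite_near (phi psi : R -> R) e b : continuous phi -> continuous psi ->
  0 <= b -> (forall t, `|phi t - psi t| <= e) ->
  `|\int[leb]_(s in `[0, b]) phi s - \int[leb]_(s in `[0, b]) psi s| <= e * b.
Proof.
move=> cphi cpsi b0 h.
rewrite -RintegralB //; [|exact: continuous_integrable|exact: continuous_integrable].
rewrite -[X in _ * X]subr0; apply: Rintegral_norm_le => //.
  by apply: continuous_integrable => t; apply: cvgB; [exact: cphi|exact: cpsi].
exact: aeW.
Qed.

(** The step 1 / (2 L) makes the integral operator a contraction by 1/2 in the uniform norm. The
    displacement bound [C * t] serves to verify afterwards that a solution of a truncated field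
    stays where the truncation is inactive. *)
Lemma picard k (g : R -> 'cV[R]_k -> 'cV[R]_k) (z0 : 'cV[R]_k) (L C : R) :
  0 < L -> (forall t z, `|g t z| <= C) ->
  (forall t z z', `|g t z - g t z'| <= L * `|z - z'|) ->
  (forall y, continuous y -> continuous (fun t => g t (y t))) ->
  exists y : R -> 'cV[R]_k, [/\ continuous y, y 0 = z0,
    forall t, 0 <= t -> `|y t - z0| <= C * t &
    forall t, 0 < t < (2 * L)^-1 -> mxderiv y t (g t (y t))].
Proof.
move=> L0 gC gL gcont; pose h := (2 * L)^-1.
have h0 : 0 < h by rewrite invr_gt0 mulr_gt0.
have C0 : 0 <= C by apply: le_trans (gC 0 0).
(* Cutting the upper limit at [h] lets [T] act on functions on the whole line, with values constant
   for [t <= 0] and for [t >= h]; uniform estimates then need no restriction on time. *)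
pose T (y : R -> 'cV[R]_k) t : 'cV[R]_k :=
  z0 + \col_i \int[leb]_(s in `[0, Num.min t h]) g s (y s) i 0.
have gc y i : continuous y -> continuous (fun t => g t (y t) i 0).
  by move=> cy; apply: (@continuous_entry _ (fun t => g t (y t))); exact: gcont.
have giC y i t : `|g t (y t) i 0| <= C.
  by apply: le_trans (norm_entry_le _ _ _) (gC _ _).
have min_lip (t t' : R) : `|Num.min t h - Num.min t' h| <= `|t - t'|.
  wlog tt' : t t' / t <= t'.
    move=> H; have [/H//|/ltW/H] := leP t t'.
    by rewrite distrC [`|t' - t|]distrC.
  rewrite distrC [`|t - t'|]distrC !ger0_norm ?subr_ge0 //; last first.
    by rewrite le_min !ge_min tt' lexx orbT.
  by have [ht'|ht'] := leP t' h; have [ht|ht] := leP t h; lra.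
have Tlip y : continuous y -> forall t t', `|T y t - T y t'| <= C * `|t - t'|.
  move=> cy t t'; apply: mx_norm_le => [|i j]; first by rewrite mulr_ge0.
  rewrite !mxE opprD addrACA subrr add0r.
  apply: le_trans (indefinite_lip (gc y i cy) (giC y i) _ _) _.
  by rewrite ler_wpM2l.
have lip_cont (y : R -> 'cV[R]_k) :
    (forall t t', `|y t - y t'| <= C * `|t - t'|) -> continuous y.
  move=> ylip t; apply/cvgrPdist_le => e e0.
  have C1 : 0 < C + 1 by rewrite ltr_wpDl.
  near=> s; apply: le_trans (ylip t s) _.
  apply: le_trans (_ : (C + 1) * `|t - s| <= e).
    by rewrite ler_wpM2r // lerDl.
  rewrite -ler_pdivlMl // mulrC; near: s.
  apply/nbhs_ballP; exists (e / (C + 1)) => /=; first by rewrite divr_gt0.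
  by move=> s; rewrite /ball /= => /ltW.
have Tc y : continuous y -> continuous (T y) by move=> /Tlip; exact: lip_cont.
have Tcontr y w e : continuous y -> continuous w -> 0 <= e ->
    (forall t, `|y t - w t| <= e) -> forall t, `|T y t - T w t| <= e / 2.
  move=> cy cw e0 yw t; apply: mx_norm_le => [|i j]; first by rewrite divr_ge0.
  rewrite !mxE opprD addrACA subrr add0r; have [m0|m0] := leP 0 (Num.min t h); last first.
    rewrite !set_itv_ge ?bnd_simp -?ltNge // !Rintegral_set0 subrr normr0.
    by rewrite divr_ge0.
  apply: le_trans (@indefinite_near _ _ (L * e) _ (gc y i cy) (gc w i cw) m0 _) _.
    move=> s; have := norm_entry_le (g s (y s) - g s (w s)) i 0.
    rewrite !mxE => /le_trans; apply; apply: le_trans (gL _ _ _) _.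
    by rewrite ler_wpM2l // ltW.
  apply: le_trans (_ : L * e * h <= _).
    by rewrite ler_wpM2l ?ge_min ?lexx ?orbT // mulr_ge0 // ltW.
  rewrite /h le_eqVlt; apply/orP; left; apply/eqP.
  by field; rewrite gt_eqF.
pose Y n := iter n T (fun=> z0).
have Yc n : continuous (Y n).
  by elim: n => [|n IHn]; [move=> ?; exact: cvg_cst|exact: Tc].
have T0 y t : continuous y -> t <= 0 -> T y t = z0.
  move=> cy t0; apply/matrixP => i j; rewrite !mxE ord1.
  have /orP[/eqP ->|tlt] : (t == 0) || (t < 0) by rewrite -le_eqVlt.
    by rewrite (min_idPl (ltW h0)) set_itv1 Rintegral_set1 addr0.
  by rewrite set_itv_ge ?bnd_simp -?ltNge ?gt_min ?tlt // Rintegral_set0 addr0.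
have YT n t : Y n.+1 t = T (Y n) t by [].
have Ystep n t : `|Y n.+1 t - Y n t| <= C * h / 2 ^+ n.
  elim: n t => [|n IHn] t.
    rewrite expr0 divr1; apply: mx_norm_le => [|i j].
      by rewrite mulr_ge0 // ltW.
    rewrite !mxE addrC addKr; have [m0|m0] := leP 0 (Num.min t h); last first.
      rewrite !set_itv_ge ?bnd_simp -?ltNge // Rintegral_set0 normr0.
      by rewrite mulr_ge0 // ltW.
    apply: le_trans (@Rintegral_norm_le _ _ 0 (Num.min t h) C m0 _ _) _.
    - by apply: continuous_integrable; apply: (gc (fun=> z0)) => ?; exact: cvg_cst.
    - by apply: aeW => s _; exact: (giC (fun=> z0)).
    - by rewrite subr0 ler_wpM2l // ge_min lexx orbT.
  rewrite !YT; apply: le_trans (Tcontr _ _ (C * h / 2 ^+ n) (Yc n.+1) (Yc n) _ IHn t) _.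
    by rewrite divr_ge0 ?exprn_ge0 // mulr_ge0 // ltW.
  by rewrite exprSr invfM mulrA.
pose y t : 'cV[R]_k := \col_i limn (fun n => Y n t i 0).
have yY n t : `|y t - Y n t| <= 2 * (C * h) / 2 ^+ n.
  apply: mx_norm_le => [|i j].
    by rewrite divr_ge0 ?exprn_ge0 // !mulr_ge0 // ltW.
  rewrite !mxE ord1; apply: (@geometric_increments (fun n => Y n t i 0)) => m.
  by apply: le_trans (Ystep m t); have := norm_entry_le (Y m.+1 t - Y m t) i 0; rewrite !mxE.
have yY0 n : 0 <= 2 * (C * h) / 2 ^+ n.
  by rewrite divr_ge0 ?exprn_ge0 // !mulr_ge0 // ltW.
have Ylip n : forall t t', `|Y n t - Y n t'| <= C * `|t - t'|.
  case: n => [|n] t t'; first by rewrite subrr normr0 mulr_ge0.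
  by rewrite !YT; exact: Tlip.
have yc : continuous y.
  apply: lip_cont => t t'; apply: (@le_geometric _ _ (4 * (C * h))) => n.
  rewrite -(subrKA (Y n t)) -[Y n t - y t'](subrKA (Y n t')).
  apply: le_trans (ler_normD _ _) _.
  apply: le_trans (lerD (yY _ _) (ler_normD _ _)) _.
  rewrite [`|Y n t' - y t'|]distrC.
  apply: le_trans (lerD (lexx _) (lerD (Ylip _ _ _) (yY n t'))) _.
  by rewrite addrCA lerD2l -mulrDl ler_wpM2r ?invr_ge0 ?exprn_ge0 //; lra.
have yT t : y t = T y t.
  apply/eqP; rewrite -subr_eq0 -normr_le0.
  apply: (@le_geometric _ _ (2 * (C * h))) => n; rewrite add0r.
  rewrite -(subrKA (Y n.+1 t)) YT.
  apply: le_trans (ler_normD _ _) _.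
  apply: le_trans (lerD (yY n.+1 t) _) _.
    apply: Tcontr (yY0 n) _ t => // s; rewrite distrC; exact: yY.
  rewrite le_eqVlt; apply/orP; left; apply/eqP.
  by rewrite exprS invfM; set c := (2 ^+ n)^-1; field.
exists y; split=> //.
- by rewrite yT T0.
- move=> t t0; rewrite yT -(T0 y 0 yc (lexx 0)).
  by apply: le_trans (Tlip y yc t 0) _; rewrite subr0 ger0_norm.
move=> t /andP[t0 th] i j; rewrite ord1.
have near_t : \near t, z0 i 0 + \int[leb]_(s in `[0, t]) g s (y s) i 0 = y t i 0.
  near=> s; rewrite yT !mxE (min_idPl _) //.
  by near: s; exact: (@cvgr_le _ _ (nbhs t) _ id t cvg_id h th).
apply: near_eq_is_derive near_t _.
have [|||dF F'] := @continuous_FTC1_closed R (fun s => g s (y s) i 0) 0 t h th.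
- exact: continuous_integrable (gc y i yc).
- by [].
- exact: (gc y i yc).
have dI : is_derive t (1 : R)
    (fun b => \int[leb]_(s in `[0, b]) g s (y s) i 0) (g t (y t) i 0).
  by apply: DeriveDef; [exact: dF|rewrite -derive1E; exact: F'].
rewrite -[X in is_derive _ _ _ X]add0r.
exact: (is_deriveD (is_derive_cst (z0 i 0) t 1) dI).
Unshelve. all: by end_near. Qed.

End Picard.

(** * Bounded Lipschitz maps and truncation *)

Section LipschitzMaps.
Context {R : realType}.

Lemma mulmx_norm_le m n p (M : 'M[R]_(m, n)) (x : 'M[R]_(n, p)) :
  `|M *m x| <= n%:R * `|M| * `|x|.
Proof.
apply: mx_norm_le => [|i j]; first by rewrite !mulr_ge0.
rewrite mxE; apply: le_trans (ler_norm_sum _ _ _) _.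
have -> : n%:R * `|M| * `|x| = \sum_(l < n) `|M| * `|x|.
  by rewrite sumr_const card_ord -mulrA mulr_natl.
by apply: ler_sum => l _; rewrite normrM ler_pM // norm_entry_le.
Qed.

Lemma lip_continuous (V W : normedModType R) (F : V -> W) C : 0 <= C ->
  (forall x y, `|F x - F y| <= C * `|x - y|) -> continuous F.
Proof.
move=> C0 FC x; apply/(@cvgrPdist_le _ _ _ _ (nbhs_filter x)) => e e0.
have C1 : 0 < C + 1 by rewrite ltr_wpDl.
apply/nbhs_ballP; exists (e / (C + 1)) => /=; first by rewrite divr_gt0.
move=> y; rewrite -ball_normE /ball_ /= => /ltW xy.
apply: le_trans (FC x y) _.
apply: le_trans (_ : (C + 1) * `|x - y| <= e).
  by rewrite ler_wpM2r // lerDl.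
by rewrite -ler_pdivlMl // mulrC.
Qed.

(* Projection of x on [c - r, c + r]. *)
Definition clamp (c r x : R) := Num.max (c - r) (Num.min x (c + r)).

Lemma clamp_lip c r x y : 0 <= r -> `|clamp c r x - clamp c r y| <= `|x - y|.
Proof.
move=> r0; wlog xy : x y / x <= y.
  move=> H; have [/H//|/ltW/H] := leP x y.
  by rewrite distrC [`|y - x|]distrC.
rewrite distrC [`|x - y|]distrC /clamp [`|y - x|]ger0_norm ?subr_ge0 //.
rewrite ler_norml; apply/andP; split.
  by have [?|?] := leP x (c + r); have [?|?] := leP y (c + r);
    rewrite /Num.max; repeat (case: ifPn; rewrite -?leNgt => ?); lra.
by have [?|?] := leP x (c + r); have [?|?] := leP y (c + r);
  rewrite /Num.max; repeat (case: ifPn; rewrite -?leNgt => ?); lra.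
Qed.

Lemma clamp_continuous (c r : R) : 0 <= r -> continuous (clamp c r).
Proof.
move=> r0 x; apply: (@lip_continuous R^o R^o (clamp c r) 1) => // {}x y.
by rewrite mul1r clamp_lip.
Qed.

Lemma clamp_id c r x : `|x - c| <= r -> clamp c r x = x.
Proof.
rewrite ler_norml => /andP[lo hi].
have h1 : x <= c + r by rewrite -lerBlDl.
have h2 : c - r <= x by rewrite -lerBrDl.
by rewrite /clamp (min_idPl h1) (max_idPr h2).
Qed.

Lemma clamp_dist c r x : 0 <= r -> `|clamp c r x - c| <= r.
Proof.
move=> r0; rewrite /clamp ler_distl; have [?|?] := leP x (c + r);
  rewrite /Num.max; case: ifPn; rewrite -?leNgt => ?; apply/andP; split; lra.
Qed.

Lemma clamp_norm c r x : 0 <= r -> `|clamp c r x| <= `|c| + r.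
Proof.
move=> r0; have h := clamp_dist c x r0.
rewrite -[clamp _ _ _](subrK c); apply: le_trans (ler_normD _ _) _.
by rewrite addrC lerD2l.
Qed.

Section BoundedLipschitz.
Variable k : nat.

(** Boundedness is included because products of Lipschitz maps are Lipschitz when the factors are
    bounded; one constant serves both bounds. *)
Definition blip (V : normedModType R) (F : 'cV[R]_k -> V) :=
  exists C, [/\ 0 <= C, forall z, `|F z| <= C &
    forall z z', `|F z - F z'| <= C * `|z - z'|].

Lemma blip_cst (V : normedModType R) (v : V) : blip (fun=> v).
Proof. by exists `|v|; split=> // z z'; rewrite subrr normr0 mulr_ge0. Qed.

Lemma blipD (V : normedModType R) (F G : 'cV[R]_k -> V) :
  blip F -> blip G -> blip (fun z => F z + G z).
Proof.
move=> [C [C0 FC FL]] [K [K0 GK GL]]; exists (C + K); split.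
- exact: addr_ge0.
- by move=> z; apply: le_trans (ler_normD _ _) (lerD _ _).
- move=> z z'; rewrite opprD addrACA mulrDl.
  by apply: le_trans (ler_normD _ _) (lerD _ _).
Qed.

(** Products of scalars, scalings, matrix products and bilinear forms are all instances, so the
    product estimate is made once. *)
Lemma blip_bilinear (U V W : normedModType R) (op : U -> V -> W) K
    (F : 'cV[R]_k -> U) (G : 'cV[R]_k -> V) : 0 <= K ->
  (forall u v, `|op u v| <= K * `|u| * `|v|) ->
  (forall u u' v, op u v - op u' v = op (u - u') v) ->
  (forall u v v', op u v - op u v' = op u (v - v')) ->
  blip F -> blip G -> blip (fun z => op (F z) (G z)).
Proof.
move=> K0 opK opl opr [C [C0 FC FL]] [B [B0 GB GL]].
exists (K * C * B + K * C * B); split.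
- by rewrite addr_ge0 // !mulr_ge0.
- move=> z; apply: le_trans (opK _ _) _.
  apply: le_trans (_ : K * C * B <= _); last by rewrite lerDl !mulr_ge0.
  by rewrite ler_pM ?mulr_ge0 // ler_wpM2l.
- move=> z z'; rewrite -(subrKA (op (F z') (G z))) opl opr mulrDl.
  apply: le_trans (ler_normD _ _) (lerD _ _).
    apply: le_trans (opK _ _) _.
    rewrite -[leRHS]mulrA [B * _]mulrC mulrA ler_pM ?mulr_ge0 //.
    by rewrite -mulrA ler_wpM2l.
  apply: le_trans (opK _ _) _.
  by rewrite -[leRHS]mulrA ler_pM ?mulr_ge0 // ler_wpM2l.
Qed.

Lemma blip_inv (F : 'cV[R]_k -> R) c : 0 < c -> (forall z, c <= F z) ->
  blip F -> blip (fun z => (F z)^-1).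
Proof.
move=> c0 Fc [C [C0 FC FL]]; exists (c^-1 + C / c ^+ 2).
have F0 z : 0 < F z by exact: lt_le_trans (Fc z).
have Fv z : (F z)^-1 <= c^-1 by rewrite lef_pV2 ?posrE.
have c2 : 0 <= C / c ^+ 2 by rewrite divr_ge0 // exprn_ge0 // ltW.
split.
- by rewrite addr_ge0 // invr_ge0 ltW.
- move=> z; rewrite ger0_norm ?invr_ge0 ?(ltW (F0 z)) //.
  by apply: le_trans (Fv z) _; rewrite lerDl.
- move=> z z'; have -> : (F z)^-1 - (F z')^-1 = (F z' - F z) * ((F z)^-1 * (F z')^-1).
    by field; rewrite !gt_eqF.
  rewrite normrM distrC.
  apply: le_trans (_ : C * `|z - z'| * (c^-1 * c^-1) <= _).
    rewrite ler_pM // ger0_norm ?mulr_ge0 ?invr_ge0 ?(ltW (F0 _)) //.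
    by rewrite ler_pM ?invr_ge0 ?(ltW (F0 _)).
  rewrite mulrAC ler_wpM2r // -invfM -expr2 lerDr invr_ge0 ltW //.
Qed.

Lemma blip_max (F : 'cV[R]_k -> R) c : 0 <= c ->
  blip F -> blip (fun z => Num.max (F z) c).
Proof.
move=> c0 [C [C0 FC FL]]; exists (C + c); split.
- exact: addr_ge0.
- move=> z; have [_|_] := leP (F z) c.
    by rewrite ger0_norm // lerDr.
  by apply: le_trans (FC z) _; rewrite lerDl.
- move=> z z'; apply: le_trans (_ : `|F z - F z'| <= _); last first.
    by apply: le_trans (FL _ _) _; rewrite ler_wpM2r // lerDl.
  rewrite ler_norml -[X in _ <= _ <= X]normrN; apply/andP; split.
    have := ler_norm (F z' - F z); rewrite distrC.
    have := normr_ge0 (F z - F z').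
    by have [?|?] := leP (F z) c; have [?|?] := leP (F z') c; lra.
  have := ler_norm (F z - F z'); rewrite normrN.
  have := normr_ge0 (F z - F z').
  by have [?|?] := leP (F z) c; have [?|?] := leP (F z') c; lra.
Qed.

(** For [0 <= r], a projection onto the ball of the maximum norm around [z0], which is a cube. *)
Definition clampv (z0 : 'cV[R]_k) r (z : 'cV[R]_k) : 'cV[R]_k :=
  \col_i clamp (z0 i 0) r (z i 0).

Lemma blip_clampv z0 r : 0 <= r -> blip (clampv z0 r).
Proof.
move=> r0; exists (1 + (`|z0| + r)); split.
- by rewrite !addr_ge0.
- move=> z; apply: mx_norm_le => [|i j]; first by rewrite !addr_ge0.
  rewrite mxE; apply: le_trans (clamp_norm _ _ r0) _.
  by rewrite ler_wpDl // lerD2r norm_entry_le.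
- move=> z z'; apply: le_trans (_ : `|z - z'| <= _); last first.
    by rewrite ler_peMl // lerDl addr_ge0.
  apply: mx_norm_le => // i j; rewrite !mxE.
  apply: le_trans (clamp_lip _ _ _ r0) _.
  by have := norm_entry_le (z - z') i 0; rewrite !mxE.
Qed.

Lemma clampv_id z0 r z : `|z - z0| <= r -> clampv z0 r z = z.
Proof.
move=> zr; apply/matrixP => i j; rewrite mxE ord1 clamp_id //.
by apply: le_trans zr; have := norm_entry_le (z - z0) i 0; rewrite !mxE.
Qed.

Lemma blip_bilform P (F G : 'cV[R]_k -> 'cV[R]_k) :
  blip F -> blip G -> blip (fun z => bilform P (F z) (G z)).
Proof.
apply: (@blip_bilinear _ _ R^o (bilform P) (k%:R * k%:R * `|P|)).
- by rewrite !mulr_ge0.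
- exact: bilform_le.
- by move=> u u' v; rewrite bilformDl -[in RHS]scaleN1r bilformZl mulN1r.
- by move=> u v v'; rewrite bilformDr bilformNr.
Qed.

Lemma blip_mulmx (M : 'M[R]_k) (F : 'cV[R]_k -> 'cV[R]_k) :
  blip F -> blip (fun z => M *m F z).
Proof.
apply: (@blip_bilinear 'M[R]_k 'cV[R]_k 'cV[R]_k (fun M x => M *m x) k%:R (fun=> M)).
- by [].
- exact: mulmx_norm_le.
- by move=> u u' v; rewrite mulmxBl.
- by move=> u v v'; rewrite mulmxBr.
- exact: blip_cst.
Qed.

Lemma blipM (F G : 'cV[R]_k -> R) :
  @blip R^o F -> @blip R^o G -> @blip R^o (fun z => F z * G z).
Proof.
apply: (@blip_bilinear R^o R^o R^o (fun x y => x * y) 1).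
- by [].
- by move=> u v; rewrite mul1r normrM.
- by move=> u u' v; rewrite mulrBl.
- by move=> u v v'; rewrite mulrBr.
Qed.

Lemma blipZ (s : 'cV[R]_k -> R) (F : 'cV[R]_k -> 'cV[R]_k) :
  @blip R^o s -> blip F -> blip (fun z => s z *: F z).
Proof.
apply: (@blip_bilinear R^o 'cV[R]_k 'cV[R]_k (fun a x => a *: x) 1).
- by [].
- by move=> u v; rewrite mul1r normrZ.
- by move=> u u' v; rewrite scalerBl.
- by move=> u v v'; rewrite scalerBr.
Qed.

End BoundedLipschitz.

End LipschitzMaps.

(** * The equation for the direction z of an outgoing solution *)

Section SphereODE.
Context {R : realType}.

Lemma blip_continuous k (F : 'cV[R]_k -> 'cV[R]_k) : blip F -> continuous F.
Proof. by move=> [C [C0 _ FL]]; exact: lip_continuous C0 FL. Qed.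

Lemma continuous_compR k l (F : 'cV[R]_k -> 'M[R]_(l, 1)) (y : R -> 'cV[R]_k) :
  continuous F -> continuous y -> continuous (fun t => F (y t)).
Proof. by move=> cF cy t; apply: continuous_cvg (cF _) (cy t). Qed.

(** The quotient by [bilform P z b] makes the field merely local. Clamping [z] to a cube around [z0]
    and cutting the denominator at half its initial value gives a bounded, globally Lipschitz field,
    and [h] is short enough for the truncation to remain inactive. In the application [m] is mu eps,
    since s = eps t turns e^(mu s) into e^(m t). *)
Lemma sphere_ode k (P A1 G : 'M[R]_k) (b z0 : 'cV[R]_k) (m rho eps : R) :
  0 < bilform P z0 b ->
  exists (h : R) (y : R -> 'cV[R]_k), [/\ 0 < h, continuous y, y 0 = z0,
    forall t, 0 <= t <= h -> 0 < bilform P (y t) b &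
    forall t, 0 < t < h -> mxderiv y t
      (expR (m * t) *: (A1 *m y t) +
       ((rho * expR (m * t) + eps) *
         (bilform P (y t) (G *m y t) / bilform P (y t) b)) *: b
       - eps *: (G *m y t))].
Proof.
set l0 := bilform P z0 b => l00.
pose K := k%:R * k%:R * `|P| * `|b|.
have K0 : 0 <= K by rewrite !mulr_ge0.
(* Within distance [r] of [z0] the denominator changes by at most [K * r <= l0 / 2]; the added 1
   covers [K = 0]. *)
pose r := l0 / (2 * (K + 1)).
have r0 : 0 < r by rewrite divr_gt0 // mulr_gt0 // ltr_wpDl.
have lr z : `|z - z0| <= r -> l0 / 2 <= bilform P z b.
  move=> zr; have -> : z = z0 + (z - z0) by rewrite addrC subrK.
  rewrite bilformDl -/l0.
  have := bilform_le P (z - z0) b; rewrite ler_norml => /andP[+ _].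
  set c := _ * `|b| => hc.
  have : c <= l0 / 2.
    apply: le_trans (_ : K * r <= _).
      by rewrite /c mulrAC ler_wpM2l.
    rewrite /r mulrA ler_pdivrMr ?mulr_gt0 // ?ltr_wpDl //.
    have -> : l0 / 2 * (2 * (K + 1)) = K * l0 + l0 by field.
    by rewrite lerDl ltW.
  by lra.
have l20 : 0 < l0 / 2 by rewrite divr_gt0.
pose zc := clampv z0 r.
pose q z := bilform P (zc z) (G *m zc z) / Num.max (bilform P (zc z) b) (l0 / 2).
have bzc : blip zc by apply: blip_clampv; exact: ltW.
have bq : @blip _ _ R^o q.
  apply: blipM; first exact: blip_bilform (blip_mulmx _ _).
  apply: (@blip_inv _ _ _ (l0 / 2)) => [//|z|]; first by rewrite le_max lexx orbT.
  by apply: blip_max; [exact: ltW|apply: blip_bilform => //; exact: blip_cst].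
pose U z := A1 *m zc z + (rho * q z) *: b.
pose W z := (eps * q z) *: b + (- eps) *: (G *m zc z).
have bU : blip U.
  apply: blipD; first exact: blip_mulmx.
  apply: blipZ; last exact: blip_cst.
  by apply: blipM => //; exact: (@blip_cst _ _ R^o).
have bW : blip W.
  apply: blipD.
    apply: blipZ; last exact: blip_cst.
    by apply: blipM => //; exact: (@blip_cst _ _ R^o).
  by apply: blipZ; [exact: (@blip_cst _ _ R^o)|exact: blip_mulmx].
(* Time is clamped to [-1, 1], which bounds the exponential factor by that of [|m|]. *)
pose a t := expR (m * clamp 0 1 t).
have acont : continuous a.
  move=> t; apply: continuous_cvg; first exact: continuous_expR.
  apply: cvgM; first exact: cvg_cst.
  exact: clamp_continuous.
have aK t : `|a t| <= expR `|m|.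
  rewrite ger0_norm ?expR_ge0 // ler_expR.
  apply: le_trans (ler_norm _) _; rewrite normrM ler_piMr //.
  by have := @clamp_norm _ 0 1 t ler01; rewrite normr0 add0r.
pose g t z := a t *: U z + W z.
have [CU [CU0 UC UL]] := bU; have [CW [CW0 WC WL]] := bW.
pose e := expR `|m|; have e0 : 0 < e by exact: expR_gt0.
have gC t z : `|g t z| <= e * CU + CW.
  apply: le_trans (ler_normD _ _) (lerD _ _) => //.
  by rewrite normrZ ler_pM.
pose L := e * CU + CW + 1.
have L0 : 0 < L by rewrite ltr_wpDl // addr_ge0 // mulr_ge0 // ltW.
have gL t z z' : `|g t z - g t z'| <= L * `|z - z'|.
  rewrite opprD addrACA -scalerBr !mulrDl mul1r.
  apply: le_trans (_ : _ <= e * CU * `|z - z'| + CW * `|z - z'|) _; last first.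
    by rewrite lerDl.
  apply: le_trans (ler_normD _ _) (lerD _ _) => //.
  by rewrite normrZ -mulrA ler_pM.
have gcont y : continuous y -> continuous (fun t => g t (y t)).
  move=> cy t; apply: cvgD.
    apply: cvgZ; first exact: acont.
    exact: (continuous_compR (blip_continuous bU) cy).
  exact: (continuous_compR (blip_continuous bW) cy).
have [y [cy y0 yC dy]] := picard z0 L0 gC gL gcont.
pose C := e * CU + CW + 1.
have C0 : 0 < C by [].
(* Three limits: the Picard interval, the range where time is not clamped, and the time to cover the
   distance [r] at speed [C]. *)
pose h := Num.min (Num.min (2 * L)^-1 1) (r / C).
have h0 : 0 < h.
  by rewrite !lt_min ltr01 andbT invr_gt0 mulr_gt0 //= divr_gt0.
have hL : h <= (2 * L)^-1 by rewrite !ge_min lexx.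
have h1 : h <= 1 by rewrite !ge_min lexx orbT.
have hr : h <= r / C by rewrite !ge_min lexx orbT.
have yr t : 0 <= t <= h -> `|y t - z0| <= r.
  move=> /andP[t0 th]; apply: le_trans (yC t t0) _.
  apply: le_trans (_ : C * h <= _); last by rewrite mulrC -ler_pdivlMr.
  by rewrite ler_pM ?addr_ge0 ?mulr_ge0 ?lerDl // ltW.
exists h, y; split=> // [t th|t /andP[t0 th]].
  exact: lt_le_trans (lr _ (yr t th)).
have tr : `|y t - z0| <= r by apply: yr; rewrite !ltW.
apply: mxderiv_eq (dy t _) _; first by rewrite t0 (lt_le_trans th).
have -> : g t (y t) = a t *: (A1 *m y t + (rho * (bilform P (y t) (G *m y t) /
    bilform P (y t) b)) *: b) + ((eps * (bilform P (y t) (G *m y t) /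
    bilform P (y t) b)) *: b + - eps *: (G *m y t)).
  by rewrite /g /U /W /q /zc !clampv_id // (max_idPl (lr _ tr)).
have -> : a t = expR (m * t).
  rewrite /a clamp_id // subr0 ger0_norm ?(ltW t0) //.
  exact: le_trans (ltW th) h1.
set c := _ / _; rewrite scalerDr scalerA scaleNr -!addrA; congr (_ + _).
rewrite !addrA; congr (_ - _); rewrite -scalerDl; congr (_ *: _); ring.
Qed.

End SphereODE.

(** * Decay of the logarithm of the norm without disturbance *)

Section Profile.
Context {R : realType}.

(* Solution of [s' = - rho exp (mu s)] on the part of the half line where
   [0 < c + d t]; for [mu < 0] it tends to -oo in finite time. *)
Lemma decay_profile (mu rho s1 : R) : 0 < rho ->
  exists (s : R -> R) (c d : R), [/\ measurable_fun setT s /\ s 0 = s1, 0 < c,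
    forall t, 0 < c + d * t ->
      is_derive t (1 : R) s (- rho * expR (mu * s t)),
    forall t, 0 <= t -> 0 < c + d * t -> s t <= s1 &
    d < 0 -> forall m, exists2 e, 0 < e &
      forall t, 0 < c + d * t -> c + d * t < e -> s t <= m].
Proof.
move=> rho0; have [->|mu0] := eqVneq mu 0.
  (* With [c = 1] and [d = 0] the condition [0 < c + d * t] holds at all times: for mu = 0 the
     origin is never reached. *)
  exists (fun t => s1 - rho * t), 1, 0; split=> //.
  - split; last by rewrite mulr0 subr0.
    apply: continuous_measurable_fun => t.
    by apply: cvgB; [exact: cvg_cst|apply: cvgM; [exact: cvg_cst|exact: cvg_id]].
  - move=> t _; rewrite mul0r expR0 mulr1.
    have H := is_deriveB (is_derive_cst s1 t 1) (is_deriveZ rho (is_derive_id t 1)).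
    apply: is_derive_eq H _.
    by rewrite sub0r /GRing.scale /= mulr1.
  - by move=> t t0 _; rewrite gerBl mulr_ge0 // ltW.
  - by rewrite ltxx.
(* Separation of variables: e^(-mu s) is the affine function [c + d * t]. *)
pose c := expR (- mu * s1); pose d := mu * rho.
have c0 : 0 < c by exact: expR_gt0.
pose s t := - (ln (c + d * t) / mu).
have aff t : is_derive t (1 : R) (fun u => c + d * u) d.
  have H := is_deriveD (is_derive_cst c t 1) (is_deriveZ d (is_derive_id t 1)).
  apply: is_derive_eq H _.
  by rewrite add0r /GRing.scale /= mulr1.
have esE t : 0 < c + d * t -> expR (mu * s t) = (c + d * t)^-1.
  by move=> ct; rewrite /s mulrN mulrC divfK // expRN lnK.
exists s, c, d; split=> //.
- split; last by rewrite /s mulr0 addr0 /c expRK mulNr mulNr opprK mulrAC mulfV ?mul1r.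
  apply: measurableT_comp => //.
  apply: measurable_funM => //.
  apply: measurableT_comp; first exact: measurable_ln.
  apply: continuous_measurable_fun => t.
  by apply: cvgD; [exact: cvg_cst|apply: cvgM; [exact: cvg_cst|exact: cvg_id]].
- move=> t ct; rewrite esE //.
  have dl := @is_derive1_comp R (@ln R) (fun u => c + d * u) t _ _ (is_derive1_ln ct) (aff t).
  have -> : s = (- mu^-1) \*: (fun u => ln (c + d * u)).
    by apply/funext => u; rewrite /s /= /GRing.scale /= mulrC mulNr.
  apply: is_derive_eq (is_deriveZ (- mu^-1) dl) _.
  rewrite /GRing.scale /= /d; field.
  by rewrite mu0 gt_eqF.
- move=> t t0 ct; rewrite -ler_expR /s.
  have [mup|mun] := ltP 0 mu.
    rewrite ler_expR lerNl ler_pdivlMr // mulNr -mulrN [s1 * _]mulrC -ler_expR lnK //.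
    by rewrite -/c lerDl mulr_ge0 // mulr_ge0 ?ltW.
  have {mu0 mun} mun : mu < 0 by rewrite lt_neqAle mu0.
  rewrite ler_expR lerNl ler_ndivlMr // mulNr -mulrN [s1 * _]mulrC -ler_expR lnK //.
  rewrite -/c gerDl mulr_le0_ge0 // nmulr_rle0 // ltW //.
- move=> d0 m; have mun : mu < 0 by move: d0; rewrite /d pmulr_llt0.
  exists (expR (- mu * m)); first exact: expR_gt0.
  move=> t ct ce; rewrite /s lerNl ler_ndivlMr // mulNr -mulrN [m * _]mulrC -ler_expR lnK //.
  by rewrite ltW.
Qed.

Lemma decay_profile_from (mu rho s1 t1 : R) : 0 < rho ->
  exists (s : R -> R) (c d : R), [/\ measurable_fun setT s /\ s t1 = s1,
    0 < c + d * t1,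
    forall t, 0 < c + d * t ->
      is_derive t (1 : R) s (- rho * expR (mu * s t)),
    forall t, t1 <= t -> 0 < c + d * t -> s t <= s1 &
    d < 0 -> forall m, exists2 e, 0 < e &
      forall t, 0 < c + d * t -> c + d * t < e -> s t <= m].
Proof.
move=> rho0; have [s [c [d [[ms s_0] c0 ds sle sm]]]] := decay_profile mu s1 rho0.
have shift t : c - d * t1 + d * t = c + d * (t - t1) by ring.
exists (fun t => s (t - t1)), (c - d * t1), d; split.
- split; last by rewrite subrr.
  apply: measurableT_comp => //; apply: continuous_measurable_fun => t.
  by apply: cvgB; [exact: cvg_id|exact: cvg_cst].
- by rewrite subrK.
- move=> t; rewrite shift => /ds dst.
  have H := is_deriveB (is_derive_id t (1 : R)) (is_derive_cst t1 t 1).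
  apply: is_derive_eq (@is_derive1_comp R s (fun u => u - t1) t _ _ dst H) _.
  by rewrite subr0 mulr1.
- by move=> t t1t; rewrite shift; apply: sle; rewrite subr_ge0.
- move=> d0 m; have [e e0 h] := sm d0 m; exists e => // t; rewrite shift.
  exact: h.
Qed.

End Profile.

(** * The closed loop *)

Section ClosedLoop.
Context {R : realType}.
Notation leb := (@lebesgue_measure R).
Variables (n p : nat) (P G A0 L : 'M[R]_n) (Q Gw : 'M[R]_p) (D : 'M[R]_(n, p)).
Variables (mu rho : R) (f : 'cV[R]_n -> 'cV[R]_n).
Hypotheses (P0 : posdef P) (S0 : posdef (P *m G + G^T *m P)).
Hypotheses (Q0 : posdef Q) (T0 : posdef (Q *m Gw + Gw^T *m Q)).
Hypotheses (rho0 : 0 < rho) (mu1 : -1 <= mu) (n0 : (0 < n)%N).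
Hypothesis f0 : f 0 = 0.
Hypothesis fE : forall x, x != 0 ->
  f x = A0 *m x + (hnorm P G x) `^ (mu + 1) *:
    (L *m dilation G (- ln (hnorm P G x)) *m x).
Hypothesis f_homo : forall x s, x != 0 ->
  f (dilation G s *m x) = expR (mu * s) *: (dilation G s *m f x).
Hypothesis D_homo : forall (w : 'cV[R]_p) s,
  D *m (dilation Gw s *m w) = expR (mu * s) *: (dilation G s *m (D *m w)).
Hypothesis lyapunov : forall z,
  bilform P z ((A0 + L) *m z) = - rho * bilform P z (G *m z).

Let N := quadform P.
Let d := dilation G.
Let q z := bilform P z (G *m z).
(** Convertible to [closed_loop A B D u] when [f] maps y to A y + B u(y). *)
Let F (omega : R -> 'cV[R]_p) (t : R) : 'cV[R]_n -> set 'cV[R]_n :=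
  filippov [set 0] (fun y => f y + D *m omega t).

Lemma sphere_neq0 z : N z = 1 -> z != 0.
Proof.
move=> Nz; apply/eqP => z0; move: Nz.
by rewrite z0 /N /quadform mulmx0 mxE => /eqP; rewrite eq_sym oner_eq0.
Qed.

Lemma sphere_bounded : exists2 C, 0 < C & forall z, N z = 1 -> `|z| <= C.
Proof.
have [C C0 CP] := posdef_lower P0.
exists (Num.sqrt C) => [|z Nz]; first by rewrite sqrtr_gt0.
rewrite -ler_sqr ?nnegrE ?sqrtr_ge0 // sqr_sqrtr ?(ltW C0) //.
by apply: le_trans (CP z) _; rewrite -/(N z) Nz mulr1.
Qed.

(** This is where [-1 <= mu] enters: the factor e^((mu + 1) s) of the feedback must stay bounded as
    s tends to -oo. *)
Lemma polar_bounded s1 : exists C, forall z s, N z = 1 -> s <= s1 ->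
  `|d s *m z| <= C /\ `|f (d s *m z)| <= C.
Proof.
have [Cz Cz0 Cz1] := sphere_bounded.
have [Cp Cp0 CpP] := posdef_lower P0.
pose C1 := n%:R * `|d s1| * Cz.
pose C2 := Num.sqrt (Cp * (n%:R * n%:R * `|P| * C1 ^+ 2)).
pose C3 := n%:R * `|A0| * C2 + expR ((mu + 1) * s1) * (n%:R * `|L| * Cz).
have C10 : 0 <= C1 by rewrite !mulr_ge0 // ltW.
have C20 : 0 <= C2 by exact: sqrtr_ge0.
have C30 : 0 <= C3 by rewrite addr_ge0 // !mulr_ge0 ?expR_ge0 // ltW.
exists (C2 + C3) => z s Nz ss1.
have dz : `|d s *m z| <= C2.
  rewrite -ler_sqr ?nnegrE // sqr_sqrtr; last first.
    by rewrite !mulr_ge0 // ltW.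
  apply: le_trans (CpP _) _; rewrite ler_pM2l //.
  apply: le_trans (_ : N (d s1 *m z) <= _).
    move: ss1; rewrite le_eqVlt => /predU1P[->//|ss1].
    by rewrite ltW // quadform_dilation_incr // sphere_neq0.
  apply: le_trans (ler_norm _) (le_trans (quadform_le _ _) _).
  rewrite ler_wpM2l ?mulr_ge0 // ler_sqr ?nnegrE //.
  apply: le_trans (mulmx_norm_le _ _) _.
  by rewrite ler_wpM2l ?mulr_ge0 // Cz1.
split; first by apply: le_trans dz _; rewrite lerDl.
apply: le_trans (_ : C3 <= _); last by rewrite lerDr.
rewrite (feedback_polar P0 S0 fE) //.
apply: le_trans (ler_normD _ _) (lerD _ _).
  apply: le_trans (mulmx_norm_le _ _) _.
  by rewrite ler_wpM2l // mulr_ge0.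
rewrite normrZ ger0_norm ?expR_ge0 // ler_pM ?expR_ge0 //.
  by rewrite ler_expR ler_wpM2l // -lerBlDr sub0r.
apply: le_trans (mulmx_norm_le _ _) _.
by rewrite ler_wpM2l ?mulr_ge0 // Cz1.
Qed.

(** Uniform in the direction [z], since [z] may keep turning while a solution approaches the
    origin. *)
Lemma polar_small e : 0 < e -> exists m, forall z s, N z = 1 -> s <= m ->
  `|d s *m z| <= e.
Proof.
move=> e0; have [Cp Cp0 CpP] := posdef_lower P0.
have [a [b [a0 _ Nd]]] := dilation_growth P0 S0.
pose m := Num.min 0 (ln (e ^+ 2 / Cp) / a).
exists m => z s Nz sm.
have s0 : 0 <= - s by rewrite oppr_ge0 (le_trans sm) // ge_min lexx.
have [+ _] := Nd (d s *m z) (- s) s0.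
rewrite mulmxA dilationNK mul1mx -/(N z) Nz => h.
rewrite -ler_sqr ?nnegrE ?(ltW e0) //; apply: le_trans (CpP _) _.
rewrite mulrC -ler_pdivlMr //.
have {}h : quadform P (d s *m z) <= expR (a * s).
  by rewrite -[a * s]opprK -mulrN expRN -[leRHS]mulr1 ler_pdivlMl ?expR_gt0.
apply: le_trans h _; rewrite -[leRHS]lnK ?posrE ?divr_gt0 ?exprn_gt0 //.
rewrite ler_expR -ler_pdivlMl // mulrC.
by apply: le_trans sm _; rewrite ge_min lexx orbT.
Qed.

Lemma polar_deriv (s : R -> R) (z : R -> 'cV[R]_n) t ds dz :
  is_derive t (1 : R) s ds -> mxderiv z t dz ->
  mxderiv (fun u => d (s u) *m z u) t (d (s t) *m (ds *: (G *m z t) + dz)).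
Proof.
move=> sds zdz.
have H := @mxderiv_comp _ _ _ d s t _ _ (dilation_derivr G (s t)) sds.
apply: mxderiv_eq (mxderivM H zdz) _.
by rewrite mulmxDr -scalemxAl -scalemxAr mulmxA.
Qed.

(* The explicit solution without disturbance; the last clause allows it to
   reach the origin when mu < 0, where f may be discontinuous. *)
Lemma nominal_solution z1 s1 t1 : N z1 = 1 ->
  exists X V : R -> 'cV[R]_n, [/\ X t1 = d s1 *m z1,
    forall i, measurable_fun setT (fun t => V t i 0),
    exists C, forall t, t1 <= t -> `|V t| <= C,
    forall i t, t1 <= t ->
      X t i 0 = X t1 i 0 + \int[leb]_(s in `[t1, t]) V s i 0 &
    forall t, t1 <= t -> X t != 0 /\ V t = f (X t) \/ X t = 0 /\ V t = 0].
Proof.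
move=> Nz1; have [s [c [e [[ms s_0] c0 ds sle se]]]] := decay_profile_from mu s1 t1 rho0.
pose M := A0 + L + rho *: G.
have MP z : bilform P z (M *m z) = 0.
  by rewrite mulmxDl bilformDr lyapunov -scalemxAl bilformZr mulNr addNr.
pose z th := dilation M th *m z1.
have dz th : mxderiv z th (M *m z th).
  apply: mxderiv_eq (mxderivM (dilation_deriv M th) (mxderiv_cst z1 th)) _.
  by rewrite mulmx0 addr0 mulmxA.
have Nz th : N (z th) = 1.
  have dN r : is_derive r (1 : R) (fun u => N (z u)) 0.
    apply: is_derive_eq (quadform_deriv P0.1 (dz r)) _.
    by rewrite MP mulr0.
  by rewrite (@is_derive_0_is_cst _ (fun u => N (z u)) th 0 dN) /z dilation0 mul1mx.
(* The curve is first parametrised by u = s. The rotation time tau satisfies tau' = e^(mu s) and s'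
   = - rho e^(mu s), so tau = (s1 - u) / rho and the factor e^(mu s) drops out of the equation for
   z. *)
pose th u := (s1 - u) / rho.
pose Xs u := d u *m z (th u).
pose Vs u := expR (mu * u) *: (d u *m ((A0 + L) *m z (th u))).
have VsE u : Vs u = f (Xs u).
  by rewrite f_homo ?sphere_neq0 // (feedback_sphere P0 S0 fE).
have dth u : is_derive u (1 : R) th (- rho^-1).
  have -> : th = (- rho^-1) \*: (fun v => v - s1).
    by apply/funext => v; rewrite /th /= /GRing.scale /= mulNr mulrC -mulrN opprB.
  have H := is_deriveB (is_derive_id u (1 : R)) (is_derive_cst s1 u 1).
  apply: is_derive_eq (is_deriveZ (- rho^-1) H) _.
  by rewrite subr0 /GRing.scale /= mulr1.
have dzth u : mxderiv (fun v => z (th v)) u ((- rho^-1) *: (M *m z (th u))).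
  exact: (@mxderiv_comp _ _ _ z th).
have dXs u : mxderiv Xs u ((- rho^-1) *: (d u *m ((A0 + L) *m z (th u)))).
  apply: mxderiv_eq (polar_deriv (is_derive_id u (1 : R)) (dzth u)) _.
  rewrite scale1r /M mulmxDl -scalemxAl scalerDr scalerA mulNr mulVf ?gt_eqF //.
  by rewrite scaleN1r addrCA subrr addr0 -scalemxAr.
have cXs : continuous Xs by apply: mxderiv_continuous => u; eexists; exact: dXs.
have cVs : continuous Vs.
  move=> u; apply: cvgZ.
    apply: continuous_cvg; first exact: continuous_expR.
    by apply: cvgM; [exact: cvg_cst|exact: cvg_id].
  apply: cvg_mulmx; first exact: mxderiv_cvg (dilation_deriv G u).
  apply: cvg_mulmx; first exact: cvg_cst.
  exact: mxderiv_cvg (dzth u).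
pose X t := if 0 < c + e * t then Xs (s t) else 0.
pose V t := if 0 < c + e * t then Vs (s t) else 0.
have caff : continuous (fun t => c + e * t).
  by move=> t; apply: cvgD; [exact: cvg_cst|apply: cvgM; [exact: cvg_cst|exact: cvg_id]].
have dX t : 0 < c + e * t -> mxderiv X t (V t).
  move=> ct; apply: (@mxderiv_near _ _ _ (fun u => Xs (s u))).
    apply: mxderiv_eq (@mxderiv_comp _ _ _ Xs s _ _ _ (dXs (s t)) (ds t ct)) _.
    rewrite /V ct scalerA /Vs; congr (_ *: _).
    by field; rewrite gt_eqF.
  near=> u; rewrite /X ifT //; near: u.
  exact: (@cvgr_gt _ _ (nbhs t) _ _ _ (caff t)).
have cV t : 0 < c + e * t -> {for t, continuous V}.
  move=> ct; have [s't _] := ds t ct.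
  have h : Vs (s u) @[u --> t] --> V t.
    rewrite /V ct; apply: continuous_cvg; first exact: cVs.
    exact/differentiable_continuous/derivable1_diffP.
  apply: cvg_trans h; apply: near_eq_cvg; near=> u; rewrite /V ifT //; near: u.
  exact: (@cvgr_gt _ _ (nbhs t) _ _ _ (caff t)).
have e_lt0 t : t1 <= t -> c + e * t <= 0 -> e < 0.
  move=> t0 ct; rewrite ltNge; apply/negP => e0.
  have : 0 < c + e * t by apply: lt_le_trans c0 _; rewrite lerD2l ler_wpM2l.
  by rewrite ltNge ct.
have cX t : t1 <= t -> 0 <= c + e * t -> {for t, continuous X}.
  move=> t0; rewrite le_eqVlt => /predU1P[ct|/dX/mxderiv_cvg//].
  have e0 : e < 0 by apply: (e_lt0 t) => //; rewrite -ct.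
  have Xt : X t = 0 by rewrite /X -ct ltxx.
  (* At the arrival time [s] tends to -oo, and smallness uniform in the direction gives continuity
     of [X] there. *)
  rewrite /prop_for /continuous_at Xt; apply/cvgrPdist_le => r r0.
  have [m mr] := polar_small r0; have [del del0 sm] := se e0 m.
  near=> u; rewrite sub0r normrN /X; case: ifPn => [cu|]; last by rewrite normr0 ltW.
  apply: mr => //; apply: sm => //; near: u.
  by apply: (@cvgr_lt _ _ (nbhs t) _ _ _ (caff t)); rewrite -ct.
have mV i : measurable_fun setT (fun t => V t i 0).
  have -> : (fun t => V t i 0) =
      (fun t => if 0 < c + e * t then Vs (s t) i 0 else 0).
    by apply/funext => t; rewrite /V; case: ifP => // _; rewrite mxE.
  apply: measurable_fun_ifT; last exact: measurable_cst.
    apply: measurable_fun_ltr; first exact: measurable_cst.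
    exact: continuous_measurable_fun.
  apply: (@measurableT_comp _ _ _ _ _ _ (fun u => Vs u i 0)) => //.
  apply: continuous_measurable_fun.
  exact: continuous_entry.
have [C Cb] := polar_bounded s1.
have VC t : t1 <= t -> `|V t| <= `|C|.
  move=> t0; rewrite /V; case: ifP => ct; last by rewrite normr0.
  rewrite VsE; have [_ /le_trans->//] := Cb _ (s t) (Nz (th (s t))) (sle t t0 ct).
  exact: ler_norm.
have VCi i t : t1 <= t -> `|V t i 0| <= `|C|.
  by move=> t0; apply: le_trans (norm_entry_le _ _ _) (VC t t0).
exists X, V; split.
- by rewrite /X c0 /Xs s_0 /th subrr mul0r /z dilation0 mul1mx.
- exact: mV.
- by exists `|C|.
- have upto i t : t1 <= t -> 0 <= c + e * t ->
      X t i 0 = X t1 i 0 + \int[leb]_(u in `[t1, t]) V u i 0.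
    move=> t0 ct.
    have pos u : t1 <= u < t -> 0 < c + e * u.
      move=> /andP[u0 ut]; have [e0|e0] := leP 0 e.
        by apply: lt_le_trans c0 _; rewrite lerD2l ler_wpM2l.
      by apply: le_lt_trans ct _; rewrite ltrD2l ltr_nM2l.
    apply: (@Rintegral_deriv _ (fun u => X u i 0) (fun u => V u i 0) t1 t `|C|) => //.
    + by move=> u /andP[u0 _]; exact: VCi.
    + apply: continuous_in_subspaceT => u; rewrite inE /= in_itv /= => /andP[u0 ut].
      have cu : 0 <= c + e * u.
        by move: ut; rewrite le_eqVlt => /predU1P[->//|ut]; rewrite ltW // pos // u0.
      by have /cvg_mxP := cX u u0 cu; exact.
    + by move=> u /andP[u0 ut]; apply: dX; rewrite pos // ltW.
    + move=> u /andP[u0 ut].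
      have cu : 0 < c + e * u by rewrite pos // ltW.
      by have /cvg_mxP := cV u cu; exact.
  move=> i t t0; have [ct|ct] := leP 0 (c + e * t); first exact: upto.
  have e0 : e < 0 by apply: (e_lt0 t) => //; exact: ltW.
  (* The arrival time: up to it the explicit solution is integrated, after it [X] and [V] vanish. *)
  pose T := - c / e.
  have cT : c + e * T = 0 by rewrite /T mulrC divfK ?lt_eqF // subrr.
  have T0' : t1 <= T by rewrite -(ler_nM2l e0) -(lerD2l c) cT ltW.
  have Tt : T <= t by rewrite -(ler_nM2l e0) -(lerD2l c) cT ltW.
  have post u : T <= u -> (0 < c + e * u) = false.
    move=> Tu; apply/negbTE; rewrite -leNgt -cT lerD2l ler_nM2l //.
  rewrite (@Rintegral_chasles _ _ t1 T t) //; last first.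
    by apply: (@bounded_integrable _ _ _ _ `|C|) => // u /andP[u0 _]; exact: VCi.
  rewrite addrA -upto ?cT // /X !post // [in X in _ = _ + X](_ : Rintegral _ _ _ = 0) ?addr0 //.
  rewrite (@eq_Rintegral _ _ _ _ _ (cst 0)).
    by rewrite Rintegral_cst // mul0r.
  by move=> u; rewrite inE /= in_itv /= => /andP[Tu _]; rewrite /V post // mxE.
- move=> t t0; rewrite /X /V; case: ifP => ct; last by right.
  left; split; last exact: VsE.
  by rewrite dilation_eq0 sphere_neq0.
Unshelve. all: by end_near. Qed.

(* lambda is chosen as the feedback for which the norm of X t is exactly
   e^(eps t); it makes z = d(-eps t) X solve an ODE on the unit sphere of P, and X
   is frozen outside [0, h] only to be continuous everywhere. *)
Lemma outgoing_arc z0 w0 : N z0 = 1 -> quadform Q w0 <= 1 ->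
  rho * q z0 < bilform P z0 (D *m w0) ->
  exists h (X V : R -> 'cV[R]_n) (omega : R -> 'cV[R]_p) z1 s1,
  [/\ [/\ 0 < h, 0 < s1, N z1 = 1, X 0 = z0 & X h = d s1 *m z1],
    [/\ continuous X, continuous V & continuous omega],
    exists C, forall t, `|V t| <= C,
    forall t, 0 < t < h -> mxderiv X t (V t) &
    forall t, [/\ X t != 0, V t = f (X t) + D *m omega t &
                  quadform Q (omega t) <= 1]].
Proof.
move=> Nz0 Qw0; set b := D *m w0; set l0 := bilform P z0 b => bad.
have q0 : 0 < q z0.
  have /(S0.2) := sphere_neq0 Nz0.
  by rewrite quadform_lyap ?P0.1 // pmulr_rgt0.
have l00 : 0 < l0 by apply: lt_trans bad; rewrite mulr_gt0.
(* Half of the excess: [(rho + eps) * q z0] is the mean of [rho * q z0] and [l0]. *)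
pose eps := (l0 - rho * q z0) / (2 * q z0).
have eps0 : 0 < eps by rewrite divr_gt0 ?subr_gt0 // mulr_gt0.
have eps_l : (rho + eps) * q z0 < l0.
  have -> : (rho + eps) * q z0 = rho * q z0 + (l0 - rho * q z0) / 2.
    by rewrite /eps; field; rewrite gt_eqF.
  by lra.
have [h1 [y [h10 cy y0 ly dy]]] := @sphere_ode _ _ P (A0 + L) G b z0 (mu * eps) rho eps l00.
(* The value for which the P-product of [y t] with its derivative vanishes, once the Lyapunov
   identity replaces z^T P (A0 + L) z by - rho z^T P G z. *)
pose lam t := (rho + eps * expR (- (mu * eps * t))) *
  (bilform P (y t) (G *m y t) / bilform P (y t) b).
pose dyt t := expR (mu * eps * t) *: ((A0 + L) *m y t + lam t *: b) - eps *: (G *m y t).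
have {}dy t : 0 < t < h1 -> mxderiv y t (dyt t).
  move=> th; apply: mxderiv_eq (dy t th) _.
  rewrite /dyt scalerDr scalerA; congr (_ + _ *: _ - _).
  rewrite /lam expRN; set c := _ / _; field.
  by rewrite gt_eqF // expR_gt0.
have Ny t : 0 <= t <= h1 -> N (y t) = 1.
  move=> /andP[t0 th]; rewrite -Nz0 -y0.
  move: t0; rewrite le_eqVlt => /predU1P[->//|t0].
  have dN u : 0 < u < h1 -> is_derive u (1 : R) (fun v => N (y v)) 0.
    move=> uh; apply: is_derive_eq (quadform_deriv P0.1 (dy u uh)) _.
    rewrite /dyt bilformDr bilformZr bilformDr lyapunov bilformNr !bilformZr.
    have lu : bilform P (y u) b != 0.
      by case/andP: uh => u0 uh; rewrite gt_eqF // ly // !ltW.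
    have -> : lam u * bilform P (y u) b =
        (rho + eps * expR (- (mu * eps * u))) * bilform P (y u) (G *m y u).
      by rewrite /lam -!mulrA mulVf // mulr1.
    rewrite expRN; field; rewrite gt_eqF ?expR_gt0 //.
  have [||c _ /eqP] := @MVT R (fun v => N (y v)) (cst 0) 0 t t0.
  - move=> u; rewrite in_itv /= => /andP[u0 ut]; apply: dN.
    by rewrite u0 (lt_le_trans ut).
  - apply: continuous_subspaceT => u.
    by apply: cvg_bilform; exact: cy.
  by rewrite mul0r subr_eq0 => /eqP.
have [a [be [_ be0 Nd]]] := dilation_growth Q0 T0.
(* A bound for [quadform Q] of the disturbance. At 0 it is ((rho + eps) q(z0) / l0)^2 < 1, so by
   continuity it stays at most 1 for a short time. *)
pose gq t := lam t ^+ 2 * expR (be * (eps * t)).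
have lam_cvg t : 0 <= t <= h1 -> lam u @[u --> t] --> lam t.
  move=> th; have lt : bilform P (y t) b != 0 by rewrite gt_eqF // ly.
  apply: cvgM.
    apply: cvgD; first exact: cvg_cst.
    apply: cvgM; first exact: cvg_cst.
    apply: continuous_cvg; first exact: continuous_expR.
    by apply: cvgN; apply: cvgM; [exact: cvg_cst|exact: cvg_id].
  apply: cvgM.
    apply: cvg_bilform; first exact: cy.
    by apply: cvg_mulmx; [exact: cvg_cst|exact: cy].
  apply: cvgV => //.
  by apply: cvg_bilform; [exact: cy|exact: cvg_cst].
have gq_cvg : gq u @[u --> 0] --> gq 0.
  apply: cvgM.
    by apply: cvgM; apply: lam_cvg; rewrite lexx ltW.
  apply: continuous_cvg; first exact: continuous_expR.
  by apply: cvgM; [exact: cvg_cst|apply: cvgM; [exact: cvg_cst|exact: cvg_id]].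
have gq0 : gq 0 < 1.
  have lam0 : lam 0 = (rho + eps) * q z0 / l0.
    by rewrite /lam mulr0 oppr0 expR0 mulr1 y0 mulrA.
  rewrite /gq !mulr0 expR0 mulr1 lam0 expr_lt1 // ?ltr_pdivrMr ?mul1r //.
  by rewrite divr_ge0 ?mulr_ge0 ?addr_ge0 // ltW.
have [r r0 gr] : exists2 r, 0 < r & forall t, 0 <= t <= r -> gq t <= 1.
  have : \forall u \near (0 : R), gq u < 1 by apply: cvgr_lt gq_cvg _ gq0.
  move=> /nbhs_ballP[r /= r0 rg].
  exists (r / 2); first by rewrite divr_gt0.
  move=> t /andP[t0 tr]; apply/ltW/rg; rewrite /ball /= sub0r normrN ger0_norm //.
  by apply: le_lt_trans tr _; rewrite ltr_pdivrMr // ltr_pMr // ltr1n.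
pose h := Num.min h1 r.
have h0 : 0 < h by rewrite lt_min h10.
have h2 : 0 <= h / 2 by rewrite divr_ge0 // ltW.
pose tau t := clamp (h / 2) (h / 2) t.
have tau_itv t : 0 <= tau t <= h.
  have := clamp_dist (h / 2) t h2; rewrite ler_distl subrr -/(tau t).
  by rewrite -splitr.
have tau_id t : 0 <= t <= h -> tau t = t.
  move=> th; rewrite /tau clamp_id // ler_distl subrr; lra.
have tau_h1 t : 0 <= tau t <= h1.
  have /andP[-> /le_trans] := tau_itv t; apply.
  by rewrite ge_min lexx.
have tau_r t : 0 <= tau t <= r.
  have /andP[-> /le_trans] := tau_itv t; apply.
  by rewrite ge_min lexx orbT.
have ctau : continuous tau by exact: clamp_continuous.
have cytau : continuous (fun t => y (tau t)).
  by move=> t; apply: (@continuous_cvg _ _ _ _ _ tau y); [exact: cy|exact: ctau].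
have clam : continuous (fun t => lam (tau t)).
  by move=> t; apply: (@continuous_cvg _ _ _ _ _ tau lam); [exact: lam_cvg|exact: ctau].
have ceps : continuous (fun t => eps * tau t).
  by move=> t; apply: cvgM; [exact: cvg_cst|exact: ctau].
have cdil k (H : 'M[R]_k) : continuous (fun t => dilation H (eps * tau t)).
  move=> t; apply: (@continuous_cvg _ _ _ _ _ (fun t => eps * tau t)).
    exact: mxderiv_cvg (dilation_deriv _ _).
  exact: ceps.
pose X t := d (eps * tau t) *m y (tau t).
pose omega t := lam (tau t) *: (dilation Gw (eps * tau t) *m w0).
pose V t := expR (mu * (eps * tau t)) *: (d (eps * tau t) *m
  ((A0 + L) *m y (tau t) + lam (tau t) *: b)).
have Xn t : X t != 0 by rewrite dilation_eq0 sphere_neq0 // Ny.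
have VE t : V t = f (X t) + D *m omega t.
  rewrite /X f_homo ?sphere_neq0 ?Ny // (feedback_sphere P0 S0 fE); last exact: Ny.
  rewrite /omega -scalemxAr D_homo /V mulmxDr scalerDr; congr (_ + _).
  by rewrite -scalemxAr !scalerA mulrC.
have Qom t : quadform Q (omega t) <= 1.
  rewrite quadformZ; apply: le_trans (gr _ (tau_r t)).
  rewrite ler_wpM2l ?sqr_ge0 //.
  have [|_ /le_trans] := Nd w0 (eps * tau t).
    by rewrite mulr_ge0 ?(ltW eps0) //; case/andP: (tau_itv t).
  by apply; rewrite ler_piMr // expR_ge0.
have dX t : 0 < t < h -> mxderiv X t (V t).
  move=> /andP[t0 th].
  have tid : tau t = t by rewrite tau_id // !ltW.
  have dt : is_derive t (1 : R) (fun u : R => eps * u) eps.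
    apply: is_derive_eq (is_deriveZ eps (is_derive_id t (1 : R))) _.
    by rewrite /GRing.scale /= mulr1.
  have dyt' : mxderiv y t (dyt t).
    by apply: dy; rewrite t0 (lt_le_trans th) // ge_min lexx.
  apply: (@mxderiv_near _ _ _ (fun u => d (eps * u) *m y u)).
    apply: mxderiv_eq (polar_deriv dt dyt') _.
    rewrite /V /dyt tid addrC subrK -scalemxAr mulrA.
    by [].
  near=> u; rewrite /X tau_id //; apply/andP; split; near: u.
    exact: (@cvgr_ge _ _ (nbhs t) _ id t cvg_id).
  exact: (@cvgr_le _ _ (nbhs t) _ id t cvg_id).
have [C Cb] := polar_bounded (eps * h).
have [Cq Cq0 CqP] := posdef_lower Q0.
exists h, X, V, omega, (y h), (eps * h); split.
- split=> //.
  + by rewrite mulr_gt0.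
  + by apply: Ny; rewrite ltW //= ge_min lexx.
  + by rewrite /X tau_id ?lexx ?ltW // mulr0 /d dilation0 mul1mx.
  + by rewrite /X tau_id ?lexx ?ltW.
- split=> t.
  + by apply: cvg_mulmx; [exact: cdil|exact: cytau].
  + apply: cvgZ.
      apply: continuous_cvg; first exact: continuous_expR.
      by apply: cvgM; [exact: cvg_cst|exact: ceps].
    apply: cvg_mulmx; first exact: cdil.
    apply: cvgD.
      by apply: cvg_mulmx; [exact: cvg_cst|exact: cytau].
    by apply: cvgZ; [exact: clam|exact: cvg_cst].
  + apply: cvgZ; first exact: clam.
    by apply: cvg_mulmx; [exact: cdil|exact: cvg_cst].
- exists (C + p%:R * `|D| * Num.sqrt Cq) => t; rewrite VE.
  apply: le_trans (ler_normD _ _) (lerD _ _).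
    have [|_ //] := Cb (y (tau t)) (eps * tau t) (Ny _ (tau_h1 t)).
    by rewrite ler_pM2l //; case/andP: (tau_itv t).
  apply: le_trans (mulmx_norm_le _ _) _; rewrite ler_wpM2l ?mulr_ge0 //.
  rewrite -ler_sqr ?nnegrE ?sqrtr_ge0 // sqr_sqrtr ?(ltW Cq0) //.
  by apply: le_trans (CqP _) _; rewrite ler_piMr // ltW.
- exact: dX.
- by [].
Unshelve. all: by end_near. Qed.

Lemma disturbance_gain : invariant_set Q F (ellipsoid P G) ->
  forall z w, N z = 1 -> quadform Q w <= 1 -> bilform P z (D *m w) <= rho * q z.
Proof.
move=> inv z w Nz Qw; rewrite leNgt; apply/negP => bad.
have [h [X1 [V1 [om [z1 [s1 [[h0 s10 Nz1 X10 X1h] [cX1 cV1 com] [C1 V1C]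
  dX1 F1]]]]]]] := outgoing_arc Nz Qw bad.
have [X2 [V2 [X2h mV2 [C2 V2C] X2int F2]]] := nominal_solution s1 h Nz1.
(* The arc is used up to and including [h], the undisturbed solution afterwards. *)
pose x t := if t <= h then X1 t else X2 t.
pose v t := if t <= h then V1 t else V2 t.
pose omega t := if t <= h then om t else 0.
have [Cq Cq0 CqP] := posdef_lower Q0.
have ifmeas (a b : R -> R) : measurable_fun setT a -> measurable_fun setT b ->
    measurable_fun setT (fun t : R => if t <= h then a t else b t).
  move=> ma mb; apply: measurable_fun_ifT => //.
  by apply: measurable_fun_ler; [exact: measurable_id|exact: measurable_cst].
have Qom t : quadform Q (omega t) <= 1.
  rewrite /omega; case: ifP => _; first by have [] := F1 t.
  by rewrite /quadform mulmx0 mxE.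
have mv i : measurable_fun setT (fun t => v t i 0).
  have -> : (fun t => v t i 0) = (fun t => if t <= h then V1 t i 0 else V2 t i 0).
    by apply/funext => t; rewrite /v; case: ifP.
  apply: ifmeas => //; apply: continuous_measurable_fun.
  exact: continuous_entry.
have adm : admissible Q omega.
  split.
  - move=> i; apply: measurable_funS (measurableT) _ _ => //.
    have -> : (fun t => omega t i 0) = (fun t => if t <= h then om t i 0 else 0).
      by apply/funext => t; rewrite /omega; case: ifP => //; rewrite mxE.
    apply: ifmeas; last exact: measurable_cst.
    by apply: continuous_measurable_fun; exact: continuous_entry.
  - exists (Num.sqrt Cq); apply: aeW => t _ i.
    apply: le_trans (norm_entry_le _ _ _) _.
    rewrite -ler_sqr ?nnegrE ?sqrtr_ge0 // sqr_sqrtr ?(ltW Cq0) //.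
    by apply: le_trans (CqP _) _; rewrite ler_piMr // ltW.
  - by apply: aeW => t _.
have vC t : 0 <= t -> `|v t| <= Num.max C1 C2.
  move=> t0; rewrite /v le_max; case: ifPn => th; first by rewrite V1C.
  by rewrite V2C ?orbT // ltW // ltNge.
have vCi i t : 0 <= t -> `|v t i 0| <= Num.max C1 C2.
  by move=> t0; apply: le_trans (norm_entry_le _ _ _) (vC t t0).
have vint i a b : 0 <= a -> leb.-integrable `[a, b] (EFin \o (fun t => v t i 0)).
  move=> a0; apply: (@bounded_integrable _ _ _ _ (Num.max C1 C2)) => // t /andP[at_ _].
  by apply: vCi; exact: le_trans at_.
have x0E : x 0 = X1 0 by rewrite /x ltW.
have part1 i t : 0 <= t <= h ->
    X1 t i 0 = X1 0 i 0 + \int[leb]_(s in `[0, t]) v s i 0.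
  move=> /andP[t0 th].
  have -> : \int[leb]_(s in `[0, t]) v s i 0 = \int[leb]_(s in `[0, t]) V1 s i 0.
    apply: eq_Rintegral => s; rewrite inE /= in_itv /= => /andP[_ st].
    by rewrite /v (le_trans st th).
  apply: (@Rintegral_deriv _ (fun u => X1 u i 0) (fun u => V1 u i 0) 0 t C1) => //.
  - by apply: continuous_measurable_fun; exact: continuous_entry.
  - by move=> u _; apply: le_trans (norm_entry_le _ _ _) (V1C u).
  - exact/continuous_subspaceT/continuous_entry.
  - by move=> u /andP[u0 ut]; apply: dX1; rewrite u0 (lt_le_trans ut).
  - by move=> u _; exact: continuous_entry.
have sol : solution (F omega) x.
  exists v; split=> [i T _|i t t0|].
  - exact: vint.
  - rewrite x0E; have [th|/ltW ht] := leP t h.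
      by rewrite {1}/x th part1 // t0.
    rewrite (@Rintegral_chasles _ _ 0 h t) ?(ltW h0) //; last exact: vint.
    rewrite addrA -part1 ?lexx ?andbT ?(ltW h0) //.
    have -> : x t i 0 = X2 t i 0.
      rewrite /x; case: ifPn => // th.
      by have -> : t = h; [apply/eqP; rewrite eq_le th|rewrite X1h X2h].
    rewrite X1h -X2h X2int //; congr (_ + _).
    (* At the gluing time [h] itself [v] takes the value of [V1], so the integrands agree only on
       the half-open interval. *)
    apply: eq_Rintegral_oc => [||s /andP[hs _]].
    + apply: (@bounded_integrable _ _ _ _ C2) => // s /andP[hs _].
      exact: le_trans (norm_entry_le _ _ _) (V2C s hs).
    + exact: vint (ltW h0).
    by rewrite /v leNgt hs.
  - apply: aeW => t t0; rewrite /x /v /F /omega; case: ifPn => th.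
      have [Xn -> _] := F1 t.
      by apply: (@filippov_mem _ _ (fun y => f y + D *m om t)); exact/eqP.
    rewrite mulmx0.
    have ht : h <= t by rewrite ltW // ltNge.
    have [[Xn ->]|[-> ->]] := F2 t ht.
      have := @filippov_mem _ _ (fun y => f y + 0) [set 0] (X2 t).
      by rewrite addr0; apply; exact/eqP.
    (* At rest in the origin the disturbance is zero, so the field is odd and admits the velocity
       0. *)
    apply: filippov_odd0 => // y; rewrite !addr0.
    exact: feedback_odd fE _ f0.
have x0in : hnorm P G (x 0) <= 1.
  have := hnorm_le P0 S0 (x 0) 0.
  by rewrite expR0 oppr0 dilation0 mul1mx x0E X10 -/(N z) Nz lexx => ->.
have : hnorm P G (x h) <= 1 by exact: (inv omega x adm sol x0in h (ltW h0)).
by rewrite /x lexx X1h (hnorm_dilation P0 S0) // -[leRHS]expR0 ler_expR leNgt s10.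
Qed.

(** In place of compactness of the sphere: [2 * q z] is the Lyapunov form, bounded below by a
    multiple of |z|^2, and [N z = 1] keeps |z| away from 0. *)
Lemma sphere_rate_lower : exists2 c, 0 < c & forall z, N z = 1 -> c <= q z.
Proof.
have [Cs Cs0 CsP] := posdef_lower S0.
pose K := 1 + n%:R * n%:R * `|P|; have K0 : 0 < K by rewrite ltr_pwDl // !mulr_ge0.
exists (2 * Cs * K)^-1 => [|z Nz]; first by rewrite invr_gt0 !mulr_gt0.
have Kz : 1 <= K * `|z| ^+ 2.
  rewrite -Nz; apply: le_trans (ler_norm _) (le_trans (quadform_le _ _) _).
  by rewrite ler_wpM2r ?exprn_ge0 // lerDr.
have := CsP z; rewrite quadform_lyap ?P0.1 // -/(q z) => Cz.
rewrite -[_^-1]mulr1 ler_pdivrMl ?mulr_gt0 //.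
apply: le_trans Kz _; rewrite -(ler_pM2l K0) in Cz.
by apply: le_trans Cz _; rewrite le_eqVlt; apply/orP; left; apply/eqP; ring.
Qed.

(** * Decay along an arbitrary solution outside the ellipsoid *)

Section Trajectory.
Hypothesis gain :
  forall z w, N z = 1 -> quadform Q w <= 1 -> bilform P z (D *m w) <= rho * q z.

(** The vector e^(a s / 2) d_w(-s) w, with [a] the growth rate of [quadform Q], still satisfies the
    constraint, so the gain inequality applies to it; dividing by the factor gives the decay. The
    rate is halved because [quadform] is the square of a norm. *)
Lemma gain_decay : exists2 a, 0 < a & forall z w s, N z = 1 ->
  quadform Q w <= 1 -> 0 <= s ->
  bilform P z (D *m (dilation Gw (- s) *m w)) <= expR (- (a * s)) * (rho * q z).
Proof.
have [a [b [a0 _ Nd]]] := dilation_growth Q0 T0.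
exists (a / 2) => [|z w s Nz Qw s0]; first by rewrite divr_gt0.
pose w1 := dilation Gw (- s) *m w.
have [+ _] := Nd w1 s s0.
rewrite /w1 mulmxA dilationKN mul1mx -/w1 => Qw1.
have Qw2 : quadform Q (expR (a / 2 * s) *: w1) <= 1.
  by rewrite quadformZ expr2 -expRD -mulrDl -splitr (le_trans Qw1 Qw).
have := gain Nz Qw2.
by rewrite -scalemxAr bilformZr expRN ler_pdivlMl ?expR_gt0.
Qed.

Variables (omega : R -> 'cV[R]_p) (x v : R -> 'cV[R]_n).
Hypothesis vi : forall (i : 'I_n) (T : R), 0 <= T ->
  leb.-integrable `[0, T] (fun t => (v t i 0)%:E).
Hypothesis xv : forall (i : 'I_n) (t : R), 0 <= t ->
  x t i 0 = x 0 i 0 + \int[leb]_(s in `[0, t]) v s i 0.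
Hypothesis vF : {ae leb, forall t, 0 <= t -> F omega t (x t) (v t)}.
Hypothesis Qomega : {ae leb, forall t, 0 <= t -> quadform Q (omega t) <= 1}.

Lemma velocity_integrable i a b : 0 <= a ->
  leb.-integrable `[a, b] (EFin \o (fun t => v t i 0)).
Proof.
move=> a0; have [ab|ba] := leP a b.
  by apply: (integrable_sub a0 (lexx b)); apply: vi; exact: le_trans ab.
by rewrite set_itv_ge ?bnd_simp -?ltNge //; exact: integrable_set0.
Qed.

Lemma trajectory_increment i a b : 0 <= a -> a <= b ->
  x b i 0 - x a i 0 = \int[leb]_(s in `[a, b]) v s i 0.
Proof.
move=> a0 ab; rewrite (xv i a0) (xv i (le_trans a0 ab)).
rewrite (@Rintegral_chasles _ _ 0 a b) //; last exact: velocity_integrable.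
by ring.
Qed.

(** An almost everywhere bound on a fixed linear functional of the velocity integrates to a bound on
    the increment; this replaces differentiation of the norm along [x]. *)
Lemma trajectory_row_le (l : 'rV[R]_n) a b c : 0 <= a -> a <= b ->
  {ae leb, forall t, a <= t <= b -> (l *m v t) 0 0 <= c} ->
  (l *m (x b - x a)) 0 0 <= c * (b - a).
Proof.
move=> a0 ab vc.
have [li le] := @Rintegral_lincomb _ _ (index_enum 'I_n) (fun i => l 0 i)
  (fun i t => v t i 0) a b (fun i => velocity_integrable i b a0).
have -> : (l *m (x b - x a)) 0 0 =
    \int[leb]_(t in `[a, b]) (\sum_(i < n) l 0 i * v t i 0).
  rewrite le mxE; apply: eq_bigr => i _.
  by rewrite -trajectory_increment // !mxE.
apply: Rintegral_ae_le => //.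
refine (@ae_imp _ _ _ vc _) => t tc /tc.
by rewrite mxE.
Qed.

(** Convergence within [[0, T]], because the integral formula constrains [x] at nonnegative times
    only. *)
Lemma trajectory_cvg (t T : R) : 0 <= t <= T ->
  x r @[r --> within `[0, T] (nbhs t)] --> x t.
Proof.
move=> /andP[t0 tT]; apply/cvg_mxP => i j; rewrite ord1.
have T_0 : 0 <= T by exact: le_trans tT.
have /subspace_continuousP := parameterized_integral_continuous T_0
  (velocity_integrable i T (lexx 0)).
move=> /(_ t); rewrite /= in_itv /= t0 tT => /(_ isT) h.
rewrite (xv i t0).
apply: cvg_trans (cvgD (cvg_cst (x 0 i 0)) h).
apply: near_eq_cvg; apply: filterS (withinT _ _) => r /=.
by rewrite in_itv /= => /andP[r0 _]; rewrite (xv i r0).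
Qed.

Lemma trajectory_near (t : R) (A : set 'cV[R]_n) : 0 <= t -> nbhs (x t) A ->
  exists2 e, 0 < e & forall r, 0 <= r -> `|r - t| <= e -> A (x r).
Proof.
move=> t0 nA; have tt1 : 0 <= t <= t + 1 by rewrite t0 lerDl ler01.
have := trajectory_cvg tt1 nA => /nbhs_ballP[e /= e0 eA].
exists (Num.min 1 (e / 2)); first by rewrite lt_min ltr01 divr_gt0.
move=> r r0; rewrite le_min => /andP[r1 re].
apply: eA; last first.
  rewrite /= in_itv /= r0 /= -lerBlDl; exact: le_trans (ler_norm _) r1.
rewrite /ball /= distrC; apply: le_lt_trans re _.
by rewrite ltr_pdivrMr // ltr_pMr // ltr1n.
Qed.

Lemma velocity_off0 : {ae leb, forall t, 0 <= t -> x t != 0 ->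
  v t = f (x t) + D *m omega t /\ quadform Q (omega t) <= 1}.
Proof.
refine (@ae_imp _ _ _ (ae_and vF Qomega) _) => t [Ft Qt] t0 xt0.
split; last exact: Qt.
apply: (@filippov_eq _ _ (fun y => f y + D *m omega t)) (Ft t0).
apply: (@cvgD _ _ _ _ (nbhs_filter (x t))); last exact: cvg_cst.
exact: feedback_continuous fE _ xt0.
Qed.

(* No chain rule for absolutely continuous functions is needed: with z frozen
   at time t, the increment of x over [t, t + h] is estimated by integrating the
   linear form z^T P d(-s) of the velocity. *)
Lemma local_decrease del S : 0 < del -> exists2 c, 0 < c &
  forall t s, 0 <= t -> del <= s <= S -> hnorm P G (x t) = expR s ->
  exists2 e, 0 < e & forall h, 0 <= h <= e ->
    hnorm P G (x (t + h)) <= expR (s - c * h).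
Proof.
move=> del0; have [a a0 decay] := gain_decay.
have [qm qm0 qmP] := sphere_rate_lower.
have [al [be [_ be0 Nd]]] := dilation_growth P0 S0.
have [Cq Cq0 CqP] := posdef_lower Q0.
(* A lower bound, uniform for del <= s <= S, of e^(mu s) rho q(z) (1 - e^(-a s)). It tends to 0 with
   [del], which is why [del] must be positive. *)
pose kap := expR (- (`|mu| * S)) * (rho * qm) * (1 - expR (- (a * del))).
have ead : 0 < 1 - expR (- (a * del)).
  by rewrite subr_gt0 -expR0 ltr_expR oppr_lt0 mulr_gt0.
have kap0 : 0 < kap by rewrite !mulr_gt0 ?expR_gt0.
(* Applying d(c h) multiplies [N] by at most e^(be c h), which is e^(kap h) for this rate, while [N]
   at d(-s) x(t + h) is at most 1 - kap h. *)
exists (kap / be) => [|t s t0 /andP[dels sS] xs]; first by rewrite divr_gt0.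
have s0 : 0 < s by exact: lt_le_trans dels.
have xt0 : x t != 0.
  apply/eqP => xt; move: xs; rewrite xt /hnorm eqxx => /esym/eqP.
  by rewrite gt_eqF // expR_gt0.
have [z [xz Nz]] : exists z, x t = d s *m z /\ N z = 1.
  have [s' [z [xz Nz]]] := hnorm_polar P0 S0 xt0.
  have sE : s = s' by apply: expR_inj; rewrite -xs xz hnorm_dilation.
  by exists z; split; [rewrite sE|].
pose l : 'rV[R]_n := z^T *m P *m d (- s).
have lE u : (l *m u) 0 0 = bilform P z (d (- s) *m u).
  by rewrite /l /bilform !mulmxA.
have lf : (l *m f (x t)) 0 0 = - (expR (mu * s) * (rho * q z)).
  rewrite lE xz f_homo ?sphere_neq0 // -scalemxAr mulmxA dilationNK mul1mx.
  rewrite bilformZr (feedback_sphere P0 S0 fE) // lyapunov.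
  by rewrite mulNr mulrN.
have lD w : quadform Q w <= 1 ->
    (l *m (D *m w)) 0 0 <= expR (- (a * del)) * (expR (mu * s) * (rho * q z)).
  move=> Qw; rewrite lE mulrCA.
  have -> : d (- s) *m (D *m w) =
      expR (mu * s) *: (D *m (dilation Gw (- s) *m w)).
    rewrite D_homo scalerA -expRD mulrN subrr expR0 scale1r.
    by [].
  rewrite bilformZr ler_pM2l ?expR_gt0 //.
  apply: le_trans (decay z w s Nz Qw (ltW s0)) _.
  rewrite ler_wpM2r ?mulr_ge0 ?(ltW rho0) ?(le_trans (ltW qm0)) ?qmP //.
  by rewrite ler_expR lerN2 ler_pM2l.
have kapE : kap <= expR (mu * s) * (rho * q z) * (1 - expR (- (a * del))).
  rewrite /kap ler_pM2r // ler_pM ?expR_ge0 // ?mulr_ge0 ?(ltW rho0) ?(ltW qm0) //.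
    rewrite ler_expR lerNl; apply: le_trans (ler_norm _) _.
    by rewrite normrN normrM ler_wpM2l // ger0_norm ?(ltW s0).
  by rewrite ler_pM2l // qmP.
have cf := feedback_continuous P0 S0 fE xt0.
have FF := nbhs_filter (x t).
have clf : (l *m f y) 0 0 @[y --> x t] --> (l *m f (x t)) 0 0.
  have : l *m f y @[y --> x t] --> l *m f (x t).
    by apply: (@cvg_mulmx _ _ _ FF) cf; exact: cvg_cst.
  by move=> /(@cvg_mxP _ _ _ FF); exact.
have lt_l : (l *m f (x t)) 0 0 < (l *m f (x t)) 0 0 + kap / 4.
  by rewrite ltrDl divr_gt0.
have lt_f : `|f (x t)| < `|f (x t)| + 1 by rewrite ltrDl.
have [e1 e10 near_l] := trajectory_near t0 (@cvgr_le _ _ _ FF _ _ clf _ lt_l).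
have [e2 e20 near_f] := trajectory_near t0 (@cvgr_norm_le _ _ _ _ FF _ _ cf _ lt_f).
have [e3 e30 near_0] := trajectory_near t0 (@cvgr_neq0 _ _ _ _ FF id (x t) cvg_id xt0).
have [e e0 [ee1 ee2 ee3]] : exists2 e, 0 < e & [/\ e <= e1, e <= e2 & e <= e3].
  exists (Num.min e1 (Num.min e2 e3)); first by rewrite !lt_min e10 e20.
  by rewrite !ge_min !lexx !orbT.
pose Cv := `|f (x t)| + 1 + p%:R * `|D| * Num.sqrt Cq.
have Cv0 : 0 <= Cv by rewrite !addr_ge0 ?mulr_ge0 ?sqrtr_ge0.
(* At the state [x t] the functional [l] of the velocity is at most - kap for every allowed
   disturbance; the variation of [f] along [x] costs a quarter of [kap]. *)
have vbounds : {ae leb, forall r, t <= r <= t + e ->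
    (l *m v r) 0 0 <= - (3 / 4 * kap) /\ `|v r| <= Cv}.
  refine (@ae_imp _ _ _ velocity_off0 _) => r vr /andP[tr rte].
  have r0 : 0 <= r by exact: le_trans tr.
  have rt : `|r - t| <= e by rewrite ger0_norm ?subr_ge0 // lerBlDl.
  have [->  Qr] := vr r0 (near_0 r r0 (le_trans rt ee3)).
  split.
    rewrite mulmxDr mxE.
    have := near_l r r0 (le_trans rt ee1); rewrite /= lf.
    have := lD _ Qr; move: kapE.
    set A1 := (l *m f (x r)) 0 0; set A2 := (l *m (D *m omega r)) 0 0.
    set B := expR (mu * s) * _; set E := expR _.
    rewrite mulrBr mulr1 [B * E]mulrC; set EB := E * B.
    by move: kap0; lra.
  apply: le_trans (ler_normD _ _) (lerD (near_f r r0 (le_trans rt ee2)) _).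
  apply: le_trans (mulmx_norm_le _ _) _; rewrite ler_wpM2l ?mulr_ge0 //.
  rewrite -ler_sqr ?nnegrE ?sqrtr_ge0 // sqr_sqrtr ?(ltW Cq0) //.
  by apply: le_trans (CqP _) _; rewrite ler_piMr // ltW.
(* [M * h ^+ 2] bounds the second order term, as [x] moves by at most [Cv * h]; [e'] makes this at
   most kap / 2 times [h]. *)
pose M := n%:R * n%:R * `|P| * (n%:R * `|d (- s)| * Cv) ^+ 2.
have M0 : 0 <= M by rewrite !mulr_ge0 // exprn_ge0 // !mulr_ge0.
pose e' := Num.min e (kap / (2 * (M + 1))).
have e'0 : 0 < e' by rewrite lt_min e0 divr_gt0 // mulr_gt0 // ltr_wpDl.
exists e' => // h /andP[h0 he'].
have he : h <= e by apply: le_trans he' _; rewrite ge_min lexx.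
have hM : M * h <= kap / 2.
  apply: le_trans (_ : (M + 1) * (kap / (2 * (M + 1))) <= _).
    rewrite ler_pM // ?lerDl //; apply: le_trans he' _.
    by rewrite ge_min lexx orbT.
  rewrite le_eqVlt; apply/orP; left; apply/eqP; field.
  by rewrite gt_eqF // ltr_wpDl.
have inh r : t <= r <= t + h -> t <= r <= t + e.
  by move=> /andP[-> /le_trans]; apply; rewrite lerD2l.
have lh : (l *m (x (t + h) - x t)) 0 0 <= - (3 / 4 * kap) * h.
  have := @trajectory_row_le l t (t + h) (- (3 / 4 * kap)) t0.
  rewrite lerDl [t + h - t]addrAC subrr add0r; apply=> //.
  by refine (@ae_imp _ _ _ vbounds _) => r vr /inh/vr[].
have dxh : `|x (t + h) - x t| <= Cv * h.
  apply: mx_norm_le => [|i j]; first by rewrite mulr_ge0.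
  rewrite ord1 !mxE trajectory_increment ?lerDl //.
  have {2}-> : h = t + h - t by rewrite addrAC subrr add0r.
  apply: Rintegral_norm_le; first by rewrite lerDl.
    exact: velocity_integrable.
  refine (@ae_imp _ _ _ vbounds _) => r vr /inh/vr[_].
  by apply: le_trans; exact: norm_entry_le.
pose Del := d (- s) *m (x (t + h) - x t).
have NDel : N Del <= kap / 2 * h.
  apply: le_trans (ler_norm _) (le_trans (quadform_le _ _) _).
  apply: le_trans (_ : M * h * h <= _); last by rewrite ler_wpM2r.
  have -> : M * h * h =
      n%:R * n%:R * `|P| * (n%:R * `|d (- s)| * (Cv * h)) ^+ 2.
    by rewrite /M; ring.
  have b0 : 0 <= n%:R * `|d (- s)| * (Cv * h) by rewrite !mulr_ge0.
  rewrite ler_wpM2l ?mulr_ge0 // ler_sqr ?nnegrE //.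
  apply: le_trans (mulmx_norm_le _ _) _.
  by rewrite ler_wpM2l ?mulr_ge0.
have yE : d (- s) *m x (t + h) = z + Del.
  by rewrite /Del mulmxBr xz (mulmxA (d (- s)) (d s)) dilationNK mul1mx subrKC.
rewrite hnorm_le //.
have -> : - (s - kap / be * h) = kap / be * h + - s by rewrite opprB.
rewrite dilationD -mulmxA yE.
have [|_ /le_trans] := Nd (z + Del) (kap / be * h).
  by rewrite mulr_ge0 // divr_ge0 ?(ltW kap0) ?(ltW be0).
apply; have -> : be * (kap / be * h) = kap * h by field; rewrite gt_eqF.
rewrite -ler_pdivlMl ?expR_gt0 // mulr1 -expRN.
(* The first order term gives - (3 / 2) kap h, the second order term at most kap h / 2; together -
   kap h. *)
apply: le_trans (expR_ge1Dx _).
rewrite quadformD ?P0.1 // -!/(N _) Nz -/(l *m _) .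
have -> : bilform P z Del = (l *m (x (t + h) - x t)) 0 0 by rewrite lE.
by move: lh NDel; set A1 := (l *m _) 0 0; set A2 := N Del; lra.
Qed.

(** The local decrease is available only for s >= del, so the envelope is flattened at [del]. It
    never exceeds [Num.max del s0], which makes one rate [c] valid at all times. *)
Lemma decay_envelope del s0 : 0 < del -> hnorm P G (x 0) <= expR s0 ->
  exists2 c, 0 < c & forall t, 0 <= t ->
    hnorm P G (x t) <= expR (Num.max del (s0 - c * t)).
Proof.
move=> del0 x0; have [c c0 dec] := local_decrease (Num.max del s0) del0.
exists c => //; pose m t := Num.max del (s0 - c * t).
have cm : continuous m.
  move=> t; apply: (@lip_continuous _ R^o R^o m c); first exact: ltW.
  move=> u w; rewrite -[c](ger0_norm (ltW c0)) -normrM mulrBr /m.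
  set cu := c * u; set cw := c * w; have := normr_ge0 (cu - cw).
  have := ler_norm (cu - cw); have := ler_norm (cw - cu); rewrite [`|cw - cu|]distrC.
  rewrite ler_norml.
  by have [?|?] := leP del (s0 - cu); have [?|?] := leP del (s0 - cw); lra.
pose g t := N (d (- m t) *m x t).
have good t : hnorm P G (x t) <= expR (m t) = (g t <= 1) by exact: hnorm_le.
have g_cvg (t T : R) : 0 <= t <= T -> g r @[r --> within `[0, T] (nbhs t)] --> g t.
  move=> tT; have xc := trajectory_cvg tT.
  have dc : d (- m r) @[r --> within `[0, T] (nbhs t)] --> d (- m t).
    apply: cvg_within_filter.
    apply: (@continuous_cvg _ _ _ _ _ (fun r => - m r) d).
      exact: mxderiv_cvg (dilation_deriv _ _).
    by apply: cvgN; exact: cm.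
  by apply: cvg_bilform; apply: cvg_mulmx.
apply: (real_induction (good := fun t => hnorm P G (x t) <= expR (m t))).
- by rewrite /m mulr0 subr0 (le_trans x0) // ler_expR le_max lexx orbT.
- move=> t t0 below; rewrite good leNgt; apply/negP => gt1.
  have tt : 0 <= t <= t by rewrite lexx ltW.
  have : \forall r \near within `[0, t] (nbhs t), 1 < g r.
    exact: cvgr_gt (g_cvg t t tt) _ gt1.
  move=> /nbhs_ballP[e /= e0 eg].
  pose u := Num.max 0 (t - e / 2).
  have ut : u < t by rewrite gt_max t0 gtrBl divr_gt0.
  have u0 : 0 <= u by rewrite le_max lexx.
  have := below u; rewrite u0 ut => /(_ isT); rewrite good leNgt.
  rewrite eg //= ?in_itv /= ?u0 ?ltW //.
  rewrite /ball /= ger0_norm ?subr_ge0 ?ltW //.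
  apply: le_lt_trans (_ : e / 2 < e); last by rewrite ltr_pdivrMr // ltr_pMr // ltr1n.
  by rewrite lerBlDr -lerBlDl le_max lexx orbT.
- move=> t t0 ht; have gle : g t <= 1 by move: ht; rewrite good.
  (* On the envelope the local decrease applies, and the envelope falls no faster than it; strictly
     below, continuity suffices. *)
  have /predU1P[gt1|gt1] : (g t == 1) || (g t < 1) by rewrite -le_eqVlt.
    have xt : hnorm P G (x t) = expR (m t) by exact: hnorm_eq.
    have mt : del <= m t <= Num.max del s0.
      rewrite le_max lexx /= ge_max !le_max lexx /=.
      by rewrite gerBl mulr_ge0 ?(ltW c0) ?orbT.
    have [e e0 eh] := dec t (m t) t0 mt xt.
    exists e => // h he; apply: le_trans (eh h he) _.
    rewrite ler_expR /m mulrDr opprD addrA max_subr_le //.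
    by rewrite mulr_ge0 ?(ltW c0) //; case/andP: he.
  have tt : 0 <= t <= t + 1 by rewrite t0 lerDl ler01.
  have : \forall r \near within `[0, t + 1] (nbhs t), g r < 1.
    exact: cvgr_lt (g_cvg t _ tt) _ gt1.
  move=> /nbhs_ballP[e /= e0 eg].
  exists (Num.min 1 (e / 2)); first by rewrite lt_min ltr01 divr_gt0.
  move=> h /andP[h0]; rewrite le_min => /andP[h1 he].
  rewrite good ltW //; apply: eg.
    rewrite /ball /= opprD addrA subrr sub0r normrN ger0_norm //.
    by apply: le_lt_trans he _; rewrite ltr_pdivrMr // ltr_pMr // ltr1n.
  by rewrite /= in_itv /= addr_ge0 // lerD2l.
Qed.

(** Once the norm is at most e^del, the point d(-del) x(t) lies in the ellipsoid, and its distance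
    to x(t) is small because d(-del) is close to the identity and x(t) is bounded. *)
Lemma trajectory_attracted : x 0 != 0 ->
  inf [set `|x t - y| | y in ellipsoid P G] @[t --> +oo] --> (0 : R).
Proof.
move=> xn0; pose s0 := ln (hnorm P G (x 0)).
have x0 : hnorm P G (x 0) <= expR s0.
  by rewrite lnK ?posrE ?hnorm_gt0.
(* [C] is fixed before [del]; it bounds all states with s <= 1, and [del <= 1] is imposed below. *)
have [C Cb] := polar_bounded (Num.max 1 s0).
apply/cvgrPdist_le => e e0.
pose K := n%:R * `|C|; have K0 : 0 <= K by rewrite mulr_ge0.
have K1 : 0 < K + 1 by rewrite ltr_wpDl.
have [del [del0 del1 dele]] : exists del, [/\ 0 < del, del <= 1 &
    `|1%:M - d (- del)| <= e / (K + 1)].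
  have dc : d (- r) @[r --> (0 : R)] --> d (- 0).
    apply: (@continuous_cvg _ _ _ _ _ (fun r => - r) d).
      exact: mxderiv_cvg (dilation_deriv _ _).
    by apply: cvgN; exact: cvg_id.
  have eK : 0 < e / (K + 1) by rewrite divr_gt0.
  move: dc; rewrite oppr0 /d dilation0 => /cvgrPdist_le/(_ _ eK).
  move=> /nbhs_ballP[r /= r0 rd].
  have m0 : 0 < Num.min 1 (r / 2) by rewrite lt_min ltr01 divr_gt0.
  exists (Num.min 1 (r / 2)); split=> //; first by rewrite ge_min lexx.
  apply: rd; rewrite /ball /= sub0r normrN ger0_norm ?(ltW m0) //.
  apply: le_lt_trans (_ : r / 2 < r); first by rewrite ge_min lexx orbT.
  by rewrite ltr_pdivrMr // ltr_pMr // ltr1n.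
have [c c0 env] := decay_envelope del0 x0.
near=> t.
have t0 : 0 <= t by near: t; apply: nbhs_pinfty_ge; exact: num_real.
have tc : (s0 - del) / c <= t by near: t; apply: nbhs_pinfty_ge; exact: num_real.
have xt : hnorm P G (x t) <= expR del.
  apply: le_trans (env t t0) _; rewrite ler_expR ge_max lexx /=.
  by rewrite lerBlDr -lerBlDl mulrC -ler_pdivrMr.
pose y := d (- del) *m x t.
have yE : ellipsoid P G y.
  have := hnorm_le P0 S0 y 0; rewrite expR0 oppr0 dilation0 mul1mx => yN.
  by move: xt; rewrite hnorm_le // -/(N y) -yN.
have xtC : `|x t| <= `|C|.
  have [->|xt0] := eqVneq (x t) 0; first by rewrite normr0.
  have [s [z [xz Nz]]] := hnorm_polar P0 S0 xt0.
  rewrite xz; have [|+ _] := Cb z s Nz.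
    move: xt; rewrite xz hnorm_dilation // ler_expR => /le_trans; apply.
    by rewrite le_max del1.
  by move=> /le_trans; apply; exact: ler_norm.
have xy : `|x t - y| <= e.
  rewrite /y -{1}(mul1mx (x t)) -mulmxBl; apply: le_trans (mulmx_norm_le _ _) _.
  apply: le_trans (_ : K * (e / (K + 1)) <= _).
    rewrite /K -mulrA [`|_ - _| * _]mulrC mulrA ler_pM ?mulr_ge0 //.
    by rewrite ler_wpM2l.
  by rewrite mulrA ler_pdivrMr // mulrC ler_pM2l // lerDl.
have lb : lbound [set `|x t - y| | y in ellipsoid P G] 0.
  by move=> _ [w _ <-].
have ne : [set `|x t - y| | y in ellipsoid P G] !=set0.
  by exists `|x t - y|; exists y.
rewrite sub0r normrN ger0_norm; last exact: lb_le_inf.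
apply: le_trans xy; apply: ge_inf; first by exists 0.
by exists y.
Unshelve. all: by end_near. Qed.

End Trajectory.

Lemma ellipsoid_attractive : invariant_set Q F (ellipsoid P G) ->
  attractive_set Q F (ellipsoid P G).
Proof.
move=> inv omega x [_ _ Qom] [v [vi xv vF]] xE.
apply: (trajectory_attracted (disturbance_gain inv) vi xv vF Qom).
apply/eqP => x0; apply: xE.
by rewrite /ellipsoid /= x0 /hnorm eqxx ler01.
Qed.

End ClosedLoop.

(** * From the matrix equations in X to the form P = X^-1 *)

Section Controller.
Context {R : realType}.

Lemma quadform_sum k (M N : 'M[R]_k) y :
  quadform (M + N) y = quadform M y + quadform N y.
Proof. by rewrite /quadform mulmxDr mulmxDl mxE. Qed.

Lemma quadform_scale k a (M : 'M[R]_k) y : quadform (a *: M) y = a * quadform M y.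
Proof. by rewrite /quadform -scalemxAr -scalemxAl mxE. Qed.

Lemma quadform_dual k (X M : 'M[R]_k) z : posdef X ->
  quadform (M *m X) (invmx X *m z) = bilform (invmx X) z (M *m z).
Proof.
move=> X0; rewrite /quadform /bilform trmx_mul (posdef_inv X0).1.
by rewrite -!mulmxA (mulKVmx (posdef_unit X0)).
Qed.

(** Congruence by the inverse of [X]: the form of P G + G^T P at [z] is that of G X + X G^T at
    [P z]. *)
Lemma posdef_dual k (X G : 'M[R]_k) : posdef X -> posdef (G *m X + X *m G^T) ->
  posdef (invmx X *m G + G^T *m invmx X).
Proof.
move=> X0 GX; have P0 := posdef_inv X0; split.
  by rewrite linearD /= !trmx_mul trmxK P0.1 addrC.
move=> z z0; rewrite quadform_lyap ?P0.1 // -quadform_dual //.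
have : 0 < quadform (G *m X + X *m G^T) (invmx X *m z).
  apply GX; apply: contraNN z0 => /eqP Pz.
  by rewrite -(mulKVmx (posdef_unit X0) z) Pz mulmx0.
rewrite quadform_sum -[X *m G^T]trmxK trmx_mul trmxK X0.1.
rewrite [quadform (_^T) _]quadformE bilform_tr -quadformE.
by rewrite mulr2n mulrDl mul1r.
Qed.

End Controller.

Theorem corollaryV1 (R : realType) (n m p : nat)
  (A : 'M[R]_n) (B : 'M[R]_(n, m)) (D : 'M[R]_(n, p)) (Q : 'M[R]_p)
  (mu : R) (Gd X : 'M[R]_n) (u : 'cV[R]_n -> 'cV[R]_m) (Gw : 'M[R]_p)
  (hn : (3 <= n)%N)
  (hA : nilpotent_mx A)
  (hD : D != 0)
  (hAB : controllable A B)
  (hQ : posdef Q)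
  (hGd : anti_hurwitz Gd)
  (hu : homogeneous_controller A B mu Gd X u)
  (hGw : anti_hurwitz Gw)
  (hf : homogeneous_field
          (fun s : R => block_mx (dilation Gd s) 0 0 (dilation Gw s)) mu
          (fun z : 'cV[R]_(n + p) =>
             col_mx (A *m usubmx z + B *m u (usubmx z) + D *m dsubmx z) 0))
  (hinv : invariant_set Q (closed_loop A B D u) (ellipsoid (invmx X) Gd))
  (hQG : posdef (Q *m Gw + Gw^T *m Q)) :
  attractive_set Q (closed_loop A B D u) (ellipsoid (invmx X) Gd).
Proof.
have [G0 [Y0 [nt [Y [rho [_ [_ /andP[mu1 _]] _ [rho0 lmi GX X0] [u0 uE]]]]]]] := hu.
set K0 := Y0 *m _ in lmi uE; set P := invmx X in uE *.
pose f y := A *m y + B *m u y.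
(* Homogeneity excludes only the origin of the product space, so [x] and [w] may vanish separately;
   this is its upper block. *)
have field_homo x w s : (x != 0) || (w != 0) ->
    f (dilation Gd s *m x) + D *m (dilation Gw s *m w) =
    expR (mu * s) *: (dilation Gd s *m (f x + D *m w)).
  move=> xw; have := hf (col_mx x w) s.
  rewrite col_mx_eq0 negb_and => /(_ xw).
  rewrite !mul_block_col !mul0mx !addr0 !add0r !col_mxKu !col_mxKd scale_col_mx.
  by move=> /eq_col_mx[].
have f_0 : f 0 = 0 by rewrite /f u0 !mulmx0 addr0.
apply: (@ellipsoid_attractive R n p P Gd (A + B *m K0) (B *m (Y *m P)) Q Gw D
  mu rho f) => //.
- exact: posdef_inv.
- exact: posdef_dual.
- by apply: leq_trans hn.
- move=> x x0; rewrite /f uE // mulmxDr mulmxDl addrA -!mulmxA.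
  by rewrite -scalemxAr.
- by move=> x s x0; have := field_homo x 0 s; rewrite x0 !mulmx0 !addr0; apply.
(* At x = 0, where [f] vanishes, joint homogeneity becomes a relation between [D] and the two
   dilations alone. *)
- move=> w s; have [->|w0] := eqVneq w 0; first by rewrite !mulmx0 scaler0.
  have := field_homo 0 w s; rewrite w0 orbT !mulmx0 f_0 !add0r; exact.
(* The matrix equation is evaluated as a quadratic form at [P *m z]. With Y = K X each term is some
   M X or its transpose and contributes z^T P M z; half of the resulting identity is the claim. *)
move=> z; have Ptr M : quadform (M *m X)^T (P *m z) = bilform P z (M *m z).
  by rewrite quadformE bilform_tr -quadformE quadform_dual.
have := congr1 (fun M => quadform M (P *m z)) lmi.
rewrite [RHS]/quadform mulmx0 mul0mx mxE !quadform_sum quadform_scale quadform_sum.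
have trX (M : 'M[R]_n) : X *m M^T = (M *m X)^T by rewrite trmx_mul X0.1.
have YE : B *m Y = B *m (Y *m P) *m X.
  by rewrite -!mulmxA mulVmx ?mulmx1 //; exact: posdef_unit.
have YTE : Y^T *m B^T = (B *m (Y *m P) *m X)^T by rewrite -YE trmx_mul.
rewrite !trX YTE YE !Ptr !quadform_dual // -/P => h.
by move: h; rewrite !mulmxDl !bilformDr; lra.
Qed.
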